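(* Let $G$ be an étale groupoid with locally compact Hausdorff unit space $X\subseteq G$ ($G$ not necessarily Hausdorff). If $G$ can be covered by countably many open bisections, then the representation $$\Lambda^{\mathrm{ess}}:=\bigoplus_{x\in X\setminus D}\lambda_x\colon C^*_{\max}(G)\to\mathbb{B}\Big(\bigoplus_{x\in X\setminus D}\ell^2(Gx)\Big)$$ induces a faithful representation $C^*_{\mathrm{ess}}(G)\hookrightarrow\mathbb{B}\big(\bigoplus_{x\in X\setminus D}\ell^2(Gx)\big)$.
   Context: $G$ is a topological groupoid with source $d(g)=g^{-1}g$ and range $r(g)=gg^{-1}$; $Gx=\{g: d(g)=x\}$. An open bisection is an open $s\subseteq G$ on which $d$ and $r$ restrict to homeomorphisms onto open subsets of $X$; étale means that the open bisections form a base of the topology. $g\in G$ is dangerous if there are a net $(g_i)$ in $G$ and $h\neq g$ in $G$ with $g_i\to g$ and $g_i\to h$; $D\subseteq G$ is the set of dangerous arrows. $\mathfrak{C}_c(G)$ is the linear span of the functions $a\colon G\to\mathbb{C}$ for which there is an open bisection $s$ such that $a$ vanishes off $s$ and $a|_s$ is continuous with compact support in $s$; it is a $*$-algebra with $(a*b)(g)=\sum_{hk=g}a(h)b(k)$, $a^*(g)=\overline{a(g^{-1})}$. $C^*_{\max}(G)$ is its completion in the largest C*-norm. For $x\in X$, $\lambda_x$ is the extension to $C^*_{\max}(G)$ of the representation of $\mathfrak{C}_c(G)$ on $\ell^2(Gx)$ given by $\lambda_x(a)\delta_h=\sum_{d(g)=r(h)}a(g)\delta_{gh}$. With $B_b(X)$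 the bounded Borel functions on $X$ and $M(X)$ the ideal of those vanishing off a meager set, $E_{\mathcal L}\colon C^*_{\max}(G)\to B_b(X)/M(X)$ is the continuous extension of $a\mapsto[a|_X]$. $C^*_{\mathrm{ess}}(G)$ is the quotient of $C^*_{\max}(G)$ by $\{b:E_{\mathcal L}(b^*b)=0\}$ (the unique quotient through which $E_{\mathcal L}$ factors as a faithful positive map). *)

(* Defs.v *)
From HB Require Import structures.
From mathcomp Require Import all_boot all_order all_algebra.
From mathcomp Require Import all_classical all_reals all_analysis.
From mathcomp Require Import finmap generic_quotient complex ring lra.
Set Implicit Arguments.
Unset Strict Implicit.
Unset Printing Implicit Defensive.
Import Order.TTheory GRing.Theory Num.Theory.
Import numFieldNormedType.Exports.
Local Open Scope classical_set_scope.
Local Open Scope ring_scope.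
Local Open Scope complex_scope.
Local Open Scope quotient_scope.

(* The inner product [hip] is linear in its first argument. *)
HB.mixin Record isHilbert (R : realType) H of CompleteNormedModule R[i] H := {
  hip : H -> H -> R[i] ;
  hipDl : forall x y z, hip (x + y) z = hip x z + hip y z ;
  hipZl : forall (c : R[i]) x y, hip (c *: x) y = c * hip x y ;
  hipC : forall x y, hip x y = (hip y x)^* ;
  hipxx : forall x, hip x x = `|x| ^+ 2
}.
#[short(type="hilbertType")]
HB.structure Definition Hilbert (R : realType) :=
  {H of CompleteNormedModule R[i] H & isHilbert R H}.

Section RealNorm.
Context {R : realType} {V : normedModType R[i]}.
Implicit Types x y : V.

(* Norms of normedModType R[i] take values in R[i]; [rnorm] is the norm as an
   element of R.  *)
Definition rnorm x : R := complex.Re `|x|.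

Lemma rnormE x : `|x| = (rnorm x)%:C.
Proof.
by rewrite /rnorm; have := ger0_Im (normr_ge0 x); case: `|x| => a b /= ->.
Qed.

Lemma rnorm_ge0 x : 0 <= rnorm x.
Proof. by have := normr_ge0 x; rewrite rnormE ler0c. Qed.

Lemma rnorm0 : rnorm 0 = 0.
Proof. by rewrite /rnorm normr0. Qed.

Lemma rnorm_eq0 x : rnorm x = 0 -> x = 0.
Proof. by move=> x0; apply: normr0_eq0; rewrite rnormE x0. Qed.

Lemma rnormD x y : rnorm (x + y) <= rnorm x + rnorm y.
Proof.
by have := ler_normD x y; rewrite !rnormE -rmorphD/= lecR.
Qed.

Lemma rnormN x : rnorm (- x) = rnorm x.
Proof. by rewrite /rnorm normrN. Qed.

Lemma rnormZ (c : R[i]) x :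
  rnorm (c *: x) = complex.Re `|c| * rnorm x.
Proof.
by rewrite /rnorm normrZ (rnormE x)/= mulr0 subr0.
Qed.

Lemma rnorm_sqD x y (a b : R) : 0 <= a -> 0 <= b -> a * b = 1 ->
  rnorm (x + y) ^+ 2 <= (1 + a) * rnorm x ^+ 2 + (1 + b) * rnorm y ^+ 2.
Proof.
move=> a0 b0 ab; have := rnormD x y.
have := rnorm_ge0 (x + y); have := rnorm_ge0 x; have := rnorm_ge0 y.
move: (rnorm x) (rnorm y) (rnorm (x + y)) => u v w v0 u0 w0 wuv.
apply: (@le_trans _ _ ((u + v) ^+ 2)); first by rewrite ler_sqr ?nnegrE ?addr_ge0.
have ub : b * (a * u - v) ^+ 2 = a * u ^+ 2 * (a * b) - u * v *+ 2 * (a * b) + b * v ^+ 2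
  by ring.
rewrite ab !mulr1 in ub.
have : 0 <= b * (a * u - v) ^+ 2 by rewrite mulr_ge0// sqr_ge0.
rewrite ub; move: (u ^+ 2) (v ^+ 2) (sqrrD u v) => u2 v2 ->; lra.
Qed.
End RealNorm.

Section HilbertTheory.
Context {R : realType} {H : hilbertType R}.
Implicit Types x y z : H.

Lemma hipDr z x y : hip z (x + y) = hip z x + hip z y.
Proof. by rewrite hipC hipDl rmorphD/= -!hipC. Qed.

Lemma hipZr (c : R[i]) x y : hip x (c *: y) = c^* * hip x y.
Proof. by rewrite hipC hipZl rmorphM/= -hipC. Qed.

Lemma hip_rnorm x : hip x x = (rnorm x ^+ 2)%:C.
Proof. by rewrite hipxx rnormE -rmorphXn. Qed.

Lemma hip_rnormD x y : rnorm (x + y) ^+ 2 =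
  rnorm x ^+ 2 + rnorm y ^+ 2 + complex.Re (hip x y) *+ 2.
Proof.
have /(congr1 (@complex.Re R)) := hip_rnorm (x + y) => /= <-.
rewrite hipDl !hipDr !hip_rnorm (hipC y x).
by case: (hip x y) => a b; rewrite /=; ring.
Qed.

Lemma Re_hip_le x y :
  `|complex.Re (hip x y)| <= rnorm x ^+ 2 + rnorm y ^+ 2.
Proof.
have p := hip_rnormD x y; have n := hip_rnormD (- x) y.
rewrite rnormN -scaleN1r hipZl mulN1r raddfN/= in n.
have pp := sqr_ge0 (rnorm (x + y)); have nn := sqr_ge0 (rnorm (-1 *: x + y)).
have xx := sqr_ge0 (rnorm x); have yy := sqr_ge0 (rnorm y).
rewrite ler_norml; apply/andP; split; lra.
Qed.

Lemma Im_hip_le x y :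
  `|complex.Im (hip x y)| <= rnorm x ^+ 2 + rnorm y ^+ 2.
Proof.
have := Re_hip_le ((0 -i* 1) *: x) y; rewrite hipZl rnormZ.
rewrite [complex.Re `|_|]/= expr0n add0r sqrrN expr1n sqrtr1 mul1r.
by case: (hip x y) => a b /=; rewrite mul0r mulN1r opprK add0r.
Qed.

End HilbertTheory.

Section RealSums.
Context {R : realType} {I : choiceType}.
Implicit Types f g p n : I -> R.

Definition summ f := (\esum_(i in [set: I]) (f i)%:E < +oo)%E.
Definition rsum0 f : R := fine (\esum_(i in [set: I]) (f i)%:E).

Lemma esum_le f (M : R) : (forall A : {fset I}, \sum_(i <- A) f i <= M) ->
  (\esum_(i in [set: I]) (f i)%:E <= M%:E)%E.
Proof.
move=> fM; apply: ge_ereal_sup => _ [A [Afin _] <-].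
by rewrite fsbig_finite//= sumEFin lee_fin.
Qed.

Lemma le_esum_fset f (A : {fset I}) : (forall i, 0 <= f i) ->
  ((\sum_(i <- A) f i)%:E <= \esum_(i in [set: I]) (f i)%:E)%E.
Proof.
move=> f0; apply: esum_ge; exists [set` A]; first by split.
by rewrite fsbig_finite//= set_fsetK sumEFin.
Qed.

Lemma summE f : (forall i, 0 <= f i) -> summ f ->
  (\esum_(i in [set: I]) (f i)%:E = (rsum0 f)%:E)%E.
Proof.
move=> f0 sf; rewrite /rsum0 fineK// ge0_fin_numE//.
by apply: esum_ge0 => i _; rewrite lee_fin.
Qed.

Lemma summ_le f (M : R) : (forall A : {fset I}, \sum_(i <- A) f i <= M) ->
  summ f.
Proof. by move=> /esum_le fM; rewrite /summ (le_lt_trans fM)// ltry. Qed.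

Lemma rsum0_le f (M : R) : (forall i, 0 <= f i) ->
  (forall A : {fset I}, \sum_(i <- A) f i <= M) -> rsum0 f <= M.
Proof.
move=> f0 fM; rewrite -lee_fin -summE//; first exact: esum_le.
exact: summ_le fM.
Qed.

Lemma le_rsum0 f (A : {fset I}) : (forall i, 0 <= f i) -> summ f ->
  \sum_(i <- A) f i <= rsum0 f.
Proof. by move=> f0 sf; rewrite -lee_fin -summE// le_esum_fset. Qed.

Lemma summ_mono f g : (forall i, f i <= g i) -> summ g -> summ f.
Proof.
by move=> fg; rewrite /summ; apply: le_lt_trans; apply: le_esum => i _;
  rewrite lee_fin.
Qed.

Lemma rsum0_ge0 f : (forall i, 0 <= f i) -> 0 <= rsum0 f.
Proof. by move=> f0; apply: fine_ge0; apply: esum_ge0 => i _; rewrite lee_fin. Qed.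

Lemma rsum0_mono f g : (forall i, 0 <= f i) -> (forall i, f i <= g i) ->
  summ g -> rsum0 f <= rsum0 g.
Proof.
move=> f0 fg sg; apply: rsum0_le => // A.
apply: le_trans (le_rsum0 A _ sg); first exact: ler_sum.
by move=> i; apply: le_trans (fg i).
Qed.

Lemma esumDr f g : (forall i, 0 <= f i) -> (forall i, 0 <= g i) ->
  (\esum_(i in [set: I]) (f i + g i)%:E =
   \esum_(i in [set: I]) (f i)%:E + \esum_(i in [set: I]) (g i)%:E)%E.
Proof.
by move=> f0 g0; rewrite -esumD// => [i _|i _]; rewrite lee_fin.
Qed.

Lemma summD f g : (forall i, 0 <= f i) -> (forall i, 0 <= g i) ->
  summ f -> summ g -> summ (fun i => f i + g i).
Proof. by move=> f0 g0 sf sg; rewrite /summ esumDr// lte_add_pinfty. Qed.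

Lemma rsum0D f g : (forall i, 0 <= f i) -> (forall i, 0 <= g i) ->
  summ f -> summ g -> rsum0 (fun i => f i + g i) = rsum0 f + rsum0 g.
Proof.
move=> f0 g0 sf sg; apply: EFin_inj; rewrite EFinD -!summE ?esumDr//.
- by move=> i; rewrite addr_ge0.
- exact: summD.
Qed.

Lemma rsum0Z_le (c : R) f : 0 <= c -> (forall i, 0 <= f i) -> summ f ->
  rsum0 (fun i => c * f i) <= c * rsum0 f.
Proof.
move=> c0 f0 sf; apply: rsum0_le => [i|A]; first by rewrite mulr_ge0.
by rewrite -mulr_sumr ler_wpM2l// le_rsum0.
Qed.

Lemma summZ (c : R) f : 0 <= c -> (forall i, 0 <= f i) -> summ f ->
  summ (fun i => c * f i).
Proof.
move=> c0 f0 sf; apply: (@summ_le _ (c * rsum0 f)) => A.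
by rewrite -mulr_sumr ler_wpM2l// le_rsum0.
Qed.

Lemma rsum0_0 : rsum0 (fun=> 0) = 0.
Proof. by rewrite /rsum0 esum1. Qed.

Lemma summ0 : summ (fun=> 0).
Proof. by rewrite /summ esum1// ltry. Qed.

Lemma rsum0Z (c : R) f : 0 <= c -> (forall i, 0 <= f i) -> summ f ->
  rsum0 (fun i => c * f i) = c * rsum0 f.
Proof.
move=> c0 f0 sf; have [->|cn0] := eqVneq c 0.
  by rewrite mul0r -[RHS]rsum0_0; congr rsum0; apply/funext => i; rewrite mul0r.
apply/le_anti; rewrite rsum0Z_le//=.
rewrite -ler_pdivlMl ?lt_neqAle 1?eq_sym ?cn0//.
have -> : f = (fun i => c^-1 * (c * f i)).
  by apply/funext => i; rewrite mulKf.
have -> : (fun i => c * (c^-1 * (c * f i))) = (fun i => c * f i).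
  by apply/funext => i; rewrite mulKf.
apply: rsum0Z_le; [by rewrite invr_ge0| |exact: summZ].
by move=> i; rewrite mulr_ge0.
Qed.

(* Unordered sum of an absolutely summable real family. *)
Definition rsum f : R :=
  rsum0 (fun i => Num.max (f i) 0) - rsum0 (fun i => Num.max (- f i) 0).

Lemma rsumE p n : (forall i, 0 <= p i) -> (forall i, 0 <= n i) ->
  summ p -> summ n -> rsum (fun i => p i - n i) = rsum0 p - rsum0 n.
Proof.
move=> p0 n0 sp sn; rewrite /rsum.
set P := (fun i => _); set N := (fun i => Num.max (- _) _).
have P0 i : 0 <= P i by rewrite le_max lexx orbT.
have N0 i : 0 <= N i by rewrite le_max lexx orbT.
have Pp i : P i <= p i by rewrite ge_max p0 andbT lerBlDr lerDl.
have Nn i : N i <= n i by rewrite ge_max n0 andbT opprB lerBlDr lerDl.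
have sP : summ P by exact: summ_mono sp.
have sN : summ N by exact: summ_mono sn.
have : rsum0 (fun i => P i + n i) = rsum0 (fun i => p i + N i).
  congr rsum0; apply/funext => i; rewrite /P /N /=.
  by case: (lerP (p i - n i) 0) => h; case: (lerP (- (p i - n i)) 0) => h'; lra.
rewrite !rsum0D// => h; lra.
Qed.

Definition abs_summ f := summ (fun i => `|f i|).

Lemma rsum_posneg f : f = fun i => Num.max (f i) 0 - Num.max (- f i) 0.
Proof.
apply/funext => i; case: (lerP (f i) 0) => h; case: (lerP (- f i) 0) => h'; lra.
Qed.

Lemma max0_ge0 f i : 0 <= Num.max (f i) 0.
Proof. by rewrite le_max lexx orbT. Qed.

Lemma abs_summ_pos f : abs_summ f -> summ (fun i => Num.max (f i) 0).
Proof. by apply: summ_mono => i; rewrite ge_max ler_norm normr_ge0. Qed.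

Lemma abs_summ_neg f : abs_summ f -> summ (fun i => Num.max (- f i) 0).
Proof. by apply: summ_mono => i; rewrite ge_max -normrN ler_norm normr_ge0. Qed.

Lemma rsumD f g : abs_summ f -> abs_summ g ->
  rsum (fun i => f i + g i) = rsum f + rsum g.
Proof.
move=> sf sg; pose P f i := Num.max (f i : R) 0.
pose N f i := Num.max (- f i : R) 0.
have -> : (fun i => f i + g i) = fun i => (P f i + P g i) - (N f i + N g i).
  apply/funext => i; rewrite {1}(rsum_posneg f) {1}(rsum_posneg g) /P /N; ring.
have P0 h i : 0 <= P h i by exact: (max0_ge0 h).
have N0 h i : 0 <= N h i by exact: (max0_ge0 (fun i => - h i)).
have [sPf sPg] := (abs_summ_pos sf, abs_summ_pos sg).
have [sNf sNg] := (abs_summ_neg sf, abs_summ_neg sg).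
rewrite rsumE ?rsum0D//; [rewrite /rsum -/(P f) -/(N f) -/(P g) -/(N g); ring|..].
- by move=> i; rewrite addr_ge0.
- by move=> i; rewrite addr_ge0.
- exact: summD.
- exact: summD.
Qed.

Lemma rsumN f : rsum (fun i => - f i) = - rsum f.
Proof.
rewrite /rsum opprB; congr (_ - rsum0 _); apply/funext => i.
by rewrite opprK.
Qed.

Lemma rsumZ (c : R) f : abs_summ f -> rsum (fun i => c * f i) = c * rsum f.
Proof.
wlog c0 : c / 0 <= c => [wh sf|sf].
  have [|/ltW c0] := leP 0 c; first by move=> /wh; exact.
  rewrite -[LHS]opprK -rsumN.
  transitivity (- rsum (fun i => (- c) * f i)).
    by congr (- rsum _); apply/funext => i; rewrite mulNr.
  by rewrite wh ?oppr_ge0// mulNr opprK.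
have P0 := max0_ge0 f; have N0 := max0_ge0 (fun i => - f i).
have [sP sN] := (abs_summ_pos sf, abs_summ_neg sf).
have -> : (fun i => c * f i) =
    fun i => c * Num.max (f i) 0 - c * Num.max (- f i) 0.
  by apply/funext => i; rewrite -mulrBr -(congr1 (@^~ i) (rsum_posneg f)).
rewrite rsumE ?rsum0Z -?mulrBr//; by
  [move=> i; rewrite mulr_ge0 | exact: summZ].
Qed.

Lemma rsum_ge0 f : (forall i, 0 <= f i) -> rsum f = rsum0 f.
Proof.
move=> f0; rewrite /rsum [X in _ - X](_ : _ = 0) ?subr0.
  by congr rsum0; apply/funext => i; apply/max_idPl.
rewrite -[RHS]rsum0_0; congr rsum0; apply/funext => i.
by apply/max_idPr; rewrite oppr_le0.
Qed.

End RealSums.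

Section HilbertSum.
Context {R : realType} {I : choiceType} (H : I -> hilbertType R).

Definition sqnorm (f : forall i, H i) : I -> R := fun i => rnorm (f i) ^+ 2.

(* The Hilbert space direct sum of the family H. *)
Record hsum : Type := HSum {
  hsum_val :> forall i, H i ;
  hsum_summ : summ (sqnorm hsum_val)
}.

Implicit Types x y z : hsum.

Lemma hsum_ext (x y : hsum) : (forall i, x i = y i) -> x = y.
Proof.
case: x y => [f fP] [g gP] /= fg.
have E : f = g by exact: functional_extensionality_dep.
by case: _ / E gP => gP; congr HSum; exact: Prop_irrelevance.
Qed.

HB.instance Definition _ := gen_eqMixin hsum.
HB.instance Definition _ := gen_choiceMixin hsum.

Lemma sqnorm_ge0 f i : 0 <= sqnorm f i.
Proof. exact: sqr_ge0. Qed.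
Hint Resolve sqnorm_ge0 : core.

Lemma sqnormD_le (f g : forall i, H i) (a b : R) i :
  0 <= a -> 0 <= b -> a * b = 1 ->
  sqnorm (fun i => f i + g i) i <= (1 + a) * sqnorm f i + (1 + b) * sqnorm g i.
Proof. by move=> *; exact: rnorm_sqD. Qed.

Lemma sqnormZ (c : R[i]) (f : forall i, H i) :
  sqnorm (fun i => c *: f i) = fun i => complex.Re `|c| ^+ 2 * sqnorm f i.
Proof. by apply/funext => i; rewrite /sqnorm rnormZ exprMn. Qed.

Lemma summ_sqnormD (f g : forall i, H i) :
  summ (sqnorm f) -> summ (sqnorm g) -> summ (sqnorm (fun i => f i + g i)).
Proof.
move=> sf sg; apply: summ_mono (fun i => _) _.
- by move=> i; exact: (@sqnormD_le f g 1 1 i ler01 ler01 (mulr1 1)).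
- by apply: summD; [| |apply: summZ|apply: summZ] => // i; rewrite mulr_ge0.
Qed.

Lemma summ_sqnormZ (c : R[i]) (f : forall i, H i) :
  summ (sqnorm f) -> summ (sqnorm (fun i => c *: f i)).
Proof. by move=> sf; rewrite sqnormZ; apply: summZ; rewrite ?sqr_ge0. Qed.

Lemma summ_sqnorm0 : summ (sqnorm (fun i => 0)).
Proof.
rewrite /summ esum1 ?ltry// => i _.
by rewrite /sqnorm rnorm0 expr0n.
Qed.

Lemma summ_sqnormN (f : forall i, H i) :
  summ (sqnorm f) -> summ (sqnorm (fun i => - f i)).
Proof.
by rewrite (_ : sqnorm (fun i => - f i) = sqnorm f)//; apply/funext => i;
  rewrite /sqnorm rnormN.
Qed.

Definition hsum_zero := HSum summ_sqnorm0.
Definition hsum_opp (x : hsum) := HSum (summ_sqnormN (hsum_summ x)).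
Definition hsum_add (x y : hsum) :=
  HSum (summ_sqnormD (hsum_summ x) (hsum_summ y)).
Definition hsum_scale (c : R[i]) (x : hsum) :=
  HSum (summ_sqnormZ c (hsum_summ x)).

Lemma hsum_addA : associative hsum_add.
Proof. by move=> x y z; apply: hsum_ext => i /=; rewrite addrA. Qed.
Lemma hsum_addC : commutative hsum_add.
Proof. by move=> x y; apply: hsum_ext => i /=; rewrite addrC. Qed.
Lemma hsum_add0 : left_id hsum_zero hsum_add.
Proof. by move=> x; apply: hsum_ext => i /=; rewrite add0r. Qed.
Lemma hsum_addN : left_inverse hsum_zero hsum_opp hsum_add.
Proof. by move=> x; apply: hsum_ext => i /=; rewrite addNr. Qed.

HB.instance Definition _ :=
  GRing.isZmodule.Build hsum hsum_addA hsum_addC hsum_add0 hsum_addN.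

Lemma hsum_scaleA a b x :
  hsum_scale a (hsum_scale b x) = hsum_scale (a * b) x.
Proof. by apply: hsum_ext => i /=; rewrite scalerA. Qed.
Lemma hsum_scale1 : left_id 1 hsum_scale.
Proof. by move=> x; apply: hsum_ext => i /=; rewrite scale1r. Qed.
Lemma hsum_scaleDr : right_distributive hsum_scale +%R.
Proof. by move=> c x y; apply: hsum_ext => i /=; rewrite scalerDr. Qed.
Lemma hsum_scaleDl x : {morph hsum_scale^~ x : a b / a + b}.
Proof. by move=> a b; apply: hsum_ext => i /=; rewrite scalerDl. Qed.

HB.instance Definition _ := GRing.Zmodule_isLmodule.Build R[i] hsum
  hsum_scaleA hsum_scale1 hsum_scaleDr hsum_scaleDl.

Definition hsum_rnorm (x : hsum) : R := Num.sqrt (rsum0 (sqnorm x)).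
Definition hsum_norm (x : hsum) : R[i] := (hsum_rnorm x)%:C.

Lemma hsum_rnorm_sq x : hsum_rnorm x ^+ 2 = rsum0 (sqnorm x).
Proof. by rewrite sqr_sqrtr// rsum0_ge0. Qed.

Lemma hsum_rnorm_ge0 x : 0 <= hsum_rnorm x.
Proof. exact: sqrtr_ge0. Qed.

Lemma hsum_rnorm_coord x i : rnorm (x i) <= hsum_rnorm x.
Proof.
rewrite -ler_sqr ?nnegrE ?rnorm_ge0 ?hsum_rnorm_ge0// hsum_rnorm_sq.
have := @le_rsum0 _ _ (sqnorm x) [fset i]%fset (sqnorm_ge0 _) (hsum_summ x).
by rewrite big_seq_fset1.
Qed.

Lemma hsum_rnorm_eq0 x : hsum_rnorm x = 0 -> x = 0.
Proof.
move=> x0; apply: hsum_ext => i; apply: rnorm_eq0; apply/le_anti.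
by rewrite rnorm_ge0 andbT -x0 hsum_rnorm_coord.
Qed.

Lemma hsum_rnorm0 : hsum_rnorm 0 = 0.
Proof.
rewrite /hsum_rnorm (_ : sqnorm _ = fun=> 0) ?rsum0_0 ?sqrtr0//.
by apply/funext => i; rewrite /sqnorm rnorm0 expr0n.
Qed.

Lemma hsum_rnormD x y : hsum_rnorm (x + y) <= hsum_rnorm x + hsum_rnorm y.
Proof.
have [x0|x0] := eqVneq (hsum_rnorm x) 0.
  by rewrite (hsum_rnorm_eq0 x0) add0r hsum_rnorm0 add0r.
have [y0|y0] := eqVneq (hsum_rnorm y) 0.
  by rewrite (hsum_rnorm_eq0 y0) addr0 hsum_rnorm0 addr0.
have X := hsum_rnorm_ge0 x; have Y := hsum_rnorm_ge0 y.
rewrite -ler_sqr ?nnegrE ?addr_ge0 ?hsum_rnorm_ge0// hsum_rnorm_sq.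
set a := hsum_rnorm y / hsum_rnorm x; set b := hsum_rnorm x / hsum_rnorm y.
have a0 : 0 <= a by rewrite divr_ge0.
have b0 : 0 <= b by rewrite divr_ge0.
have ab : a * b = 1 by rewrite /a /b; field; rewrite x0 y0.
pose F i := (1 + a) * sqnorm x i; pose G i := (1 + b) * sqnorm y i.
have F0 i : 0 <= F i by rewrite mulr_ge0// addr_ge0.
have G0 i : 0 <= G i by rewrite mulr_ge0// addr_ge0.
have sF : summ F by apply: summZ; rewrite ?addr_ge0//; exact: hsum_summ.
have sG : summ G by apply: summZ; rewrite ?addr_ge0//; exact: hsum_summ.
apply: (@le_trans _ _ (rsum0 (fun i => F i + G i))).
  by apply: rsum0_mono => // [i|]; [exact: sqnormD_le|exact: summD].
rewrite rsum0D// rsum0Z ?addr_ge0//; last exact: hsum_summ.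
rewrite rsum0Z ?addr_ge0//; last exact: hsum_summ.
rewrite -!hsum_rnorm_sq /a /b.
rewrite le_eqVlt; apply/orP; left; apply/eqP; field.
by rewrite x0 y0.
Qed.

Lemma hsum_normD x y : hsum_norm (x + y) <= hsum_norm x + hsum_norm y.
Proof. by rewrite -rmorphD lecR hsum_rnormD. Qed.

Lemma hsum_normZ (c : R[i]) x : hsum_norm (c *: x) = `|c| * hsum_norm x.
Proof.
rewrite /hsum_norm /hsum_rnorm sqnormZ rsum0Z ?sqr_ge0//; last exact: hsum_summ.
have cE : `|c| = (complex.Re `|c|)%:C.
  by have := ger0_Im (normr_ge0 c); case: `|c| => u v /= ->.
have c0 : 0 <= complex.Re `|c| by have := normr_ge0 c; rewrite {1}cE ler0c.
by rewrite sqrtrM ?sqr_ge0// sqrtr_sqr ger0_norm// rmorphM/= -cE.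
Qed.

Lemma hsum_norm_eq0 x : hsum_norm x = 0 -> x = 0.
Proof. by case => /hsum_rnorm_eq0. Qed.

HB.instance Definition _ := Lmodule_isNormed.Build R[i] hsum
  hsum_normD hsum_normZ hsum_norm_eq0.

Lemma hsum_rnormE (x : hsum) : rnorm x = hsum_rnorm x.
Proof. by []. Qed.

End HilbertSum.

Section Sums2.
Context {R : realType}.

Lemma cvg_sum_seq (T : Type) (I : Type) (F : set_system T) (s : seq I)
    (f : I -> T -> R) (l : I -> R) : Filter F ->
  (forall i, f i @ F --> l i) ->
  (fun t => \sum_(i <- s) f i t) @ F --> \sum_(i <- s) l i.
Proof.
move=> FF fl; elim: s => [|i s IH].
  by rewrite big_nil; under eq_fun do rewrite big_nil; exact: cvg_cst.
rewrite big_cons; under eq_fun do rewrite big_cons; exact: cvgD.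
Qed.

Lemma ge0_realC (c : R[i]) : 0 <= c -> c = (complex.Re c)%:C.
Proof. by move=> /ger0_Im; case: c => a b /= ->. Qed.

Lemma gt0_realC (c : R[i]) : 0 < c -> c = (complex.Re c)%:C /\ 0 < complex.Re c.
Proof.
by move=> c0; have cE := ge0_realC (ltW c0); split=> //; rewrite -ltcR -cE.
Qed.

Lemma ler_rnorm (V W : normedModType R[i]) (x : V) (y : W) :
  rnorm x <= rnorm y -> `|x| <= `|y|.
Proof. by rewrite !rnormE; rewrite -lecR. Qed.

Lemma ltr_rnorm (V : normedModType R[i]) (x : V) (r : R) :
  (`|x| < r%:C) = (rnorm x < r).
Proof. by rewrite rnormE -ltcR. Qed.

Lemma rnorm_dist (V : normedModType R[i]) (x y : V) :
  `|rnorm x - rnorm y| <= rnorm (x - y).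
Proof.
rewrite ler_norml; apply/andP; split.
  by rewrite lerNl opprB lerBlDr -(rnormN (x - y)) opprB (le_trans _ (rnormD _ _))// subrK.
by rewrite lerBlDr (le_trans _ (rnormD _ _))// subrK.
Qed.

Lemma cvg_rnorm (T : Type) (F : set_system T) (V : normedModType R[i])
    (f : T -> V) (l x : V) : Filter F ->
  f @ F --> l -> (fun t => rnorm (x - f t)) @ F --> rnorm (x - l).
Proof.
move=> FF fl; apply/cvgrPdist_lt => e e0.
have e0' : 0 < e%:C by rewrite ltcR.
have /cvgrPdist_lt/(_ _ e0') := fl; apply: filterS => t.
rewrite ltr_rnorm => h; apply: le_lt_trans (rnorm_dist _ _) _.
by rewrite opprB addrC addrA subrK -opprB rnormN.
Qed.

End Sums2.

Section HilbertSumComplete.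
Context {R : realType} {I : choiceType} (H : I -> hilbertType R).
Notation hs := (hsum H).

Lemma hsum_complete (F : set_system hs) : ProperFilter F -> cauchy F -> cvg F.
Proof.
move=> FF /cauchyP Fc.
have Fi i : cvg ((fun x : hs => x i) @ F).
  apply: cauchy_cvg; apply: cauchy_exP => e e0.
  have [x Fx] := Fc e e0; exists (x i).
  change (F ((fun x : hs => x i) @^-1` ball (x i) e)).
  apply: filterS Fx => y /=.
  rewrite -!ball_normE /ball_ /= => h; apply: le_lt_trans h.
  by apply: ler_rnorm; exact: (hsum_rnorm_coord (x - y) i).
pose l i := lim ((fun x : hs => x i) @ F).
have key (r : R) (x : hs) : 0 < r -> F (ball x r%:C) ->
    forall A : {fset I}, \sum_(i <- A) rnorm (x i - l i) ^+ 2 <= r ^+ 2.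
  move=> r0 Fx A.
  have cv : (fun y : hs => \sum_(i <- A) rnorm (x i - y i) ^+ 2) @ F -->
      (\sum_(i <- A) rnorm (x i - l i) ^+ 2 : R).
    apply: cvg_sum_seq => i; rewrite expr2; under eq_fun do rewrite expr2.
    by apply: cvgM; apply: cvg_rnorm; exact: Fi.
  apply: (cvgr_to_le cv).
  apply: filterS (Fx) => y; rewrite -ball_normE /ball_ /= ltr_rnorm hsum_rnormE => xy.
  apply: le_trans (le_rsum0 A (sqnorm_ge0 _) (hsum_summ (x - y))) _.
  by rewrite -hsum_rnorm_sq ler_sqr ?nnegrE ?hsum_rnorm_ge0 ?ltW.
have [x0 Fx0] := Fc 1 ltr01.
have s0 : summ (sqnorm (fun i => x0 i - l i)).
  by apply: summ_le; apply: (key 1 x0 ltr01); exact: Fx0.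
have sl : summ (sqnorm l).
  rewrite (_ : l = fun i => x0 i + - (x0 i - l i)).
    exact: summ_sqnormD (hsum_summ x0) (summ_sqnormN s0).
  by apply: functional_extensionality_dep => i; rewrite opprB addrC subrK.
pose L : hs := HSum sl.
apply/cvg_ex; exists L; apply/cvg_ballP => e /gt0_realC[-> r0].
set r := complex.Re e in r0 *.
have h0 : 0 < r / 2 by rewrite divr_gt0.
have h0' : 0 < (r / 2)%:C by rewrite ltcR.
have [x Fx] := Fc _ h0'; apply: filterS (Fx) => y xy.
move: xy; rewrite -!ball_normE /ball_ /= !ltr_rnorm => xy.
have xL : rnorm (x - L) <= r / 2.
  rewrite hsum_rnormE -ler_sqr ?nnegrE ?hsum_rnorm_ge0 ?(ltW h0)//.
  rewrite hsum_rnorm_sq; apply: rsum0_le => [i|A]; first exact: sqnorm_ge0.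
  exact: key Fx A.
rewrite (_ : L - y = - (x - L) + (x - y)); last by rewrite opprB addrA subrK.
apply: le_lt_trans (rnormD _ _) _; rewrite rnormN; lra.
Qed.

HB.instance Definition _ := Uniform_isComplete.Build hs hsum_complete.

Definition csum (f : I -> R[i]) : R[i] :=
  rsum (fun i => complex.Re (f i)) +i* rsum (fun i => complex.Im (f i)).

Definition hsum_ip (x y : hs) : R[i] := csum (fun i => hip (x i) (y i)).

Lemma hsum_ip_abs (x y : hs) :
  abs_summ (fun i => complex.Re (hip (x i) (y i))) /\
  abs_summ (fun i => complex.Im (hip (x i) (y i))).
Proof.
have s : summ (fun i => sqnorm x i + sqnorm y i).
  by apply: summD; [exact: sqnorm_ge0|exact: sqnorm_ge0|exact: hsum_summ..].
split; apply: summ_mono s => i; [exact: Re_hip_le|exact: Im_hip_le].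
Qed.

Lemma hsum_ipDl (x y z : hs) : hsum_ip (x + y) z = hsum_ip x z + hsum_ip y z.
Proof.
have [rx ix] := hsum_ip_abs x z; have [ry iy] := hsum_ip_abs y z.
rewrite /hsum_ip /csum; apply/eqP; rewrite eq_complex /=; apply/andP.
by split; apply/eqP; rewrite -rsumD//; congr rsum; apply/funext => i;
  rewrite hipDl raddfD.
Qed.

Lemma hsum_ipZl (c : R[i]) (x y : hs) : hsum_ip (c *: x) y = c * hsum_ip x y.
Proof.
have [rx ix] := hsum_ip_abs x y; case: c => a b.
rewrite /hsum_ip /csum; apply/eqP; rewrite eq_complex /=; apply/andP.
have sZ (k : R) f : abs_summ f -> abs_summ (fun i : I => k * f i).
  move=> sf; rewrite /abs_summ; under eq_fun do rewrite normrM.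
  by apply: summZ.
split; apply/eqP; rewrite -?rsumZ// -?rsumN -rsumD ?sZ//.
- by congr rsum; apply/funext => i; rewrite hipZl; case: (hip _ _).
- by rewrite /abs_summ; under eq_fun do rewrite normrN; exact: sZ.
- by congr rsum; apply/funext => i; rewrite hipZl; case: (hip _ _).
Qed.

Lemma hsum_ipC (x y : hs) : hsum_ip x y = (hsum_ip y x)^*.
Proof.
rewrite /hsum_ip /csum /=; congr (_ +i* _); rewrite -?rsumN;
  by congr rsum; apply/funext => i; rewrite hipC; case: (hip _ _).
Qed.

Lemma hsum_ipxx (x : hs) : hsum_ip x x = `|x| ^+ 2.
Proof.
rewrite rnormE -rmorphXn/= hsum_rnormE hsum_rnorm_sq /hsum_ip /csum.
congr (_ +i* _).
  rewrite -rsum_ge0; last exact: sqnorm_ge0.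
  by congr rsum; apply/funext => i; rewrite hip_rnorm.
rewrite (_ : (fun i => _) = fun=> 0); first by rewrite rsum_ge0// rsum0_0.
by apply/funext => i; rewrite hip_rnorm.
Qed.

HB.instance Definition _ := isHilbert.Build R hs
  hsum_ipDl hsum_ipZl hsum_ipC hsum_ipxx.
End HilbertSumComplete.

Section ComplexHilbert.
Context {R : realType}.

Lemma abs_Re_le (z : R[i]) : `|complex.Re z| <= complex.Re `|z|.
Proof.
case: z => a b /=; rewrite -sqrtr_sqr ler_sqrt ?addr_ge0 ?sqr_ge0//.
by rewrite lerDl sqr_ge0.
Qed.

Lemma abs_Im_le (z : R[i]) : `|complex.Im z| <= complex.Re `|z|.
Proof.
case: z => a b /=; rewrite -sqrtr_sqr ler_sqrt ?addr_ge0 ?sqr_ge0//.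
by rewrite lerDr sqr_ge0.
Qed.

Lemma norm_ReIm_le (z : R[i]) :
  complex.Re `|z| <= `|complex.Re z| + `|complex.Im z|.
Proof.
case: z => a b /=; rewrite -ler_sqr ?nnegrE ?sqrtr_ge0 ?addr_ge0//.
rewrite sqr_sqrtr ?addr_ge0 ?sqr_ge0// sqrrD !real_normK ?num_real//.
by rewrite lerD2r lerDl mulrn_wge0// mulr_ge0.
Qed.

Lemma complex_complete (F : set_system R[i]^o) :
  ProperFilter F -> cauchy F -> cvg F.
Proof.
move=> FF /cauchyP Fc.
have Fg (g : R[i] -> R) : (forall x y, `|g x - g y| <= complex.Re `|x - y|) ->
    cvg (g @ F).
  move=> gl; apply: cauchy_cvg; apply: cauchy_exP => e e0.
  have [|x Fx] := Fc e%:C; first by rewrite ltcR.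
  exists (g x).
  change (F (g @^-1` ball (g x) e)).
  apply: filterS Fx => y /=.
  rewrite -!ball_normE /ball_ /= => h; apply: le_lt_trans (gl _ _) _.
  by rewrite -ltcR.
have /Fg/cvg_ex[a Fa] : forall x y : R[i],
    `|complex.Re x - complex.Re y| <= complex.Re `|x - y|.
  by move=> x y; rewrite -raddfB; exact: abs_Re_le.
have /Fg/cvg_ex[b Fb] : forall x y : R[i],
    `|complex.Im x - complex.Im y| <= complex.Re `|x - y|.
  by move=> x y; rewrite -raddfB; exact: abs_Im_le.
apply/cvg_ex; exists (a +i* b); apply/cvg_ballP => e /gt0_realC[-> r0].
have h0 : 0 < complex.Re e / 2 by rewrite divr_gt0.
have /cvgrPdist_lt/(_ _ h0) Fa' := Fa; have /cvgrPdist_lt/(_ _ h0) Fb' := Fb.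
apply: filterS2 Fa' Fb' => z az bz.
rewrite -ball_normE /ball_ /= ltcR; case: z az bz => u v /= au bv.
have := norm_ReIm_le ((a - u) +i* (b - v)); rewrite /= => h.
apply: le_lt_trans h _; lra.
Qed.

(* Alias of R[i]: completeness cannot be declared on R[i]^o, where the library
   already declares it for R^o with R : realType.  *)
Definition complexH : Type := R[i]^o.
HB.instance Definition _ := NormedModule.copy complexH R[i]^o.
HB.instance Definition _ := isPointed.Build complexH (0 : R[i]^o).
HB.instance Definition _ := Uniform_isComplete.Build complexH complex_complete.

Definition complex_ip : complexH -> complexH -> R[i] :=
  fun x y : R[i] => x * y^*.

Lemma complex_ipDl x y z :
  complex_ip (x + y) z = complex_ip x z + complex_ip y z.
Proof. exact: mulrDl. Qed.
Lemma complex_ipZl (c : R[i]) x y :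
  complex_ip (c *: x) y = c * complex_ip x y.
Proof. by rewrite /complex_ip -mulrA. Qed.
Lemma complex_ipC x y : complex_ip x y = (complex_ip y x)^*.
Proof. by rewrite /complex_ip rmorphM/= conjcK mulrC. Qed.
Lemma complex_ipxx x : complex_ip x x = `|x| ^+ 2.
Proof. by rewrite /complex_ip -sqr_normc. Qed.

HB.instance Definition _ := isHilbert.Build R complexH
  complex_ipDl complex_ipZl complex_ipC complex_ipxx.
End ComplexHilbert.
Arguments complexH : clear implicits.

Section Ell2.
Context {R : realType} {T : choiceType} (S : set T).

Definition ell2 : Type := hsum (fun _ : set_type S => (complexH R : hilbertType R)).
HB.instance Definition _ := Hilbert.on ell2.

Definition delta_fun (k : T) (s : set_type S) : complexH R :=
  (if set_val s == k then 1 else 0) : R[i].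

Lemma delta_summ (k : T) : summ (sqnorm (delta_fun k)).
Proof.
apply: (@summ_le _ _ _ 1) => A.
have E s : sqnorm (delta_fun k) s = (if set_val s == k then 1 else 0).
  rewrite /sqnorm /delta_fun; case: ifP => _; last by rewrite rnorm0 expr0n.
  by rewrite /rnorm /= expr0n addr0 !expr1n sqrtr1 expr1n.
under eq_bigr do rewrite E.
have [[s0 [s0A s0k]]|no] := pselect (exists s, s \in A /\ set_val s = k).
  rewrite (bigD1_seq s0)//= s0k eqxx big1 ?addr0// => s /eqP ss0.
  case: eqP => // sk; exfalso; apply: ss0; apply: val_inj.
  by rewrite -!set_valE sk.
rewrite big_seq big1// => s sA; case: eqP => // sk.
by exfalso; apply: no; exists s.
Qed.

(* For k not in S this is the zero vector. *)
Definition ell2_delta (k : T) : ell2 := HSum (delta_summ k).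
End Ell2.
Arguments ell2 R {T} S.
Arguments ell2_delta {R T} S k.

HB.mixin Record isCStarAlgebra (R : realType) A of CompleteNormedModule R[i] A := {
  cmul : A -> A -> A ;
  cstar : A -> A ;
  cmulA : associative cmul ;
  cmulDl : left_distributive cmul +%R ;
  cmulDr : right_distributive cmul +%R ;
  cmulZl : forall (c : R[i]) a b, cmul (c *: a) b = c *: cmul a b ;
  cmulZr : forall (c : R[i]) a b, cmul a (c *: b) = c *: cmul a b ;
  cstarK : involutive cstar ;
  cstarD : {morph cstar : a b / a + b} ;
  cstarZ : forall (c : R[i]) a, cstar (c *: a) = c^* *: cstar a ;
  cstarM : forall a b, cstar (cmul a b) = cmul (cstar b) (cstar a) ;
  cnormM : forall a b, `|cmul a b| <= `|a| * `|b| ;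
  cnorm_star : forall a, `|cmul (cstar a) a| = `|a| ^+ 2
}.
(* Not necessarily unital, hence not built on MathComp's algType. *)
#[short(type="cstarAlgType")]
HB.structure Definition CStarAlgebra (R : realType) :=
  {A of CompleteNormedModule R[i] A & isCStarAlgebra R A}.

Definition star_hom (R : realType) (A B : cstarAlgType R) (f : A -> B) : Prop :=
  [/\ linear f,
      forall a b, f (cmul a b) = cmul (f a) (f b) &
      forall a, f (cstar a) = cstar (f a)].

Definition bounded_operator (R : realType) (H : hilbertType R) (T : H -> H) :=
  linear T /\ continuous T.

Definition star_representation (R : realType) (A : cstarAlgType R)
    (H : hilbertType R) (pi : A -> H -> H) : Prop :=
  [/\ forall a, bounded_operator (pi a),
      forall (c : R[i]) a b xi, pi (c *: a + b) xi = c *: pi a xi + pi b xi,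
      forall a b xi, pi (cmul a b) xi = pi a (pi b xi) &
      forall a xi eta, hip (pi a xi) eta = hip xi (pi (cstar a) eta)].

(* The product [gmul g h] is only meaningful when d(g) = r(h), where
   d(g) = g^-1 g and r(g) = g g^-1; it takes junk values otherwise.  *)
HB.mixin Record isTopologicalGroupoid G of Topological G := {
  gmul : G -> G -> G ;
  ginv : G -> G ;
  ginvK : involutive ginv ;
  gmul_src : forall g h, gmul (ginv g) g = gmul h (ginv h) ->
    gmul (ginv (gmul g h)) (gmul g h) = gmul (ginv h) h ;
  gmul_rng : forall g h, gmul (ginv g) g = gmul h (ginv h) ->
    gmul (gmul g h) (ginv (gmul g h)) = gmul g (ginv g) ;
  gmulA : forall g h k, gmul (ginv g) g = gmul h (ginv h) ->
    gmul (ginv h) h = gmul k (ginv k) ->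
    gmul g (gmul h k) = gmul (gmul g h) k ;
  gmulKV : forall g h, gmul (ginv g) g = gmul h (ginv h) ->
    gmul (ginv g) (gmul g h) = h ;
  gmulVK : forall g h, gmul (ginv g) g = gmul h (ginv h) ->
    gmul (gmul g h) (ginv h) = g ;
  gmul_continuous :
    {within [set p : G * G | gmul (ginv p.1) p.1 = gmul p.2 (ginv p.2)],
      continuous (fun p => gmul p.1 p.2)} ;
  ginv_continuous : continuous ginv
}.
#[short(type="topGroupoidType")]
HB.structure Definition TopologicalGroupoid :=
  {G of Topological G & isTopologicalGroupoid G}.

Section Groupoid.
Context {G : topGroupoidType}.
Implicit Types (g h : G) (s : set G).

Definition src g : G := gmul (ginv g) g.
Definition rng g : G := gmul g (ginv g).
Definition units : set G := range src.
Definition unit_space : Type := set_type units.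
HB.instance Definition _ := Topological.on unit_space.

(* The restriction of f to s is a homeomorphism onto an open subset of X. *)
Definition homeo_onto_open_units s (f : G -> G) : Prop :=
  [/\ f @` s `<=` units,
      open ([set x | (f @` s) (set_val x)] : set unit_space),
      {within s, continuous f} &
      exists2 f' : G -> G, (forall g, s g -> f' (f g) = g) &
        {within f @` s, continuous f'}].

Definition open_bisection s : Prop :=
  [/\ open s, homeo_onto_open_units s src & homeo_onto_open_units s rng].

Definition fiber (x : unit_space) : set G := [set g | src g = set_val x].

Definition directed (I : Type) (le : I -> I -> Prop) : Prop :=
  [/\ inhabited I, forall i, le i i,
      forall i j k, le i j -> le j k -> le i k &
      forall i j, exists k, le i k /\ le j k].

Definition net_cvg (I : Type) (le : I -> I -> Prop) (u : I -> G) g : Prop :=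
  forall U, nbhs g U -> exists i0, forall i, le i0 i -> U (u i).

Definition dangerous g : Prop :=
  exists (I : Type) (le : I -> I -> Prop) (u : I -> G) h,
    [/\ directed le, h <> g, net_cvg le u g & net_cvg le u h].

End Groupoid.
Arguments units : clear implicits.
Arguments unit_space : clear implicits.

Definition etale (G : topGroupoidType) : Prop :=
  forall (g : G) (U : set G), open U -> U g ->
    exists s : set G, [/\ open_bisection s, s g & s `<=` U].

Definition safe_units (G : topGroupoidType) : set (unit_space G) :=
  [set x | ~ dangerous (set_val x)].

Section ConvolutionAlgebra.
Context {R : realType} {G : topGroupoidType}.
Implicit Types a b : G -> R[i]^o.

(* The closure is taken in the space s, so that it is the support of a|_s. *)
Definition bisection_function a : Prop :=
  exists s : set G,
    [/\ open_bisection s, forall g, ~ s g -> a g = 0,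
        continuous (fun g : set_type s => a (set_val g)) &
        compact (closure [set g : set_type s | a (set_val g) != 0])].

Definition Cc : set (G -> R[i]^o) :=
  [set a | exists n (c : 'I_n -> R[i]) (f : 'I_n -> G -> R[i]^o),
    (forall i, bisection_function (f i)) /\ a = \sum_(i < n) c i *: f i].

(* For a and b in Cc only finitely many terms of this sum are nonzero. *)
Definition gconv a b : G -> R[i]^o := fun g =>
  \sum_(p \in [set p : G * G | src p.1 = rng p.2 /\ gmul p.1 p.2 = g])
    (a p.1 * b p.2).

Definition gadj a : G -> R[i]^o := fun g => (a (ginv g) : R[i])^*.

Definition cstar_norm (N : (G -> R[i]^o) -> R[i]) : Prop :=
  [/\ forall a, Cc a -> 0 <= N a /\ (N a = 0 -> a = 0),
      forall a b, Cc a -> Cc b -> N (a + b) <= N a + N b,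
      forall (c : R[i]) a, Cc a -> N (c *: a) = `|c| * N a,
      forall a b, Cc a -> Cc b -> N (gconv a b) <= N a * N b &
      forall a, Cc a -> N (gconv (gadj a) a) = N a ^+ 2].

Definition largest_cstar_norm (N : (G -> R[i]^o) -> R[i]) : Prop :=
  cstar_norm N /\
  forall N', cstar_norm N' -> forall a, Cc a -> N' a <= N a.

(* [A] is C*_max(G), with [iota] the inclusion of Cc; the values of [iota]
   off Cc are irrelevant.  *)
Definition is_Cmax (A : cstarAlgType R) (iota : (G -> R[i]^o) -> A) : Prop :=
  [/\ forall (c : R[i]) a b, Cc a -> Cc b ->
        iota (c *: a + b) = c *: iota a + iota b,
      forall a b, Cc a -> Cc b -> iota (gconv a b) = cmul (iota a) (iota b),
      forall a, Cc a -> iota (gadj a) = cstar (iota a),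
      largest_cstar_norm (fun a => `|iota a|) &
      dense (iota @` Cc)].

(* [lam] extends lambda_x : Cc -> B(l^2(G x)), which is determined by its values
   on the basis vectors delta_h.  *)
Definition is_lambda (A : cstarAlgType R) (iota : (G -> R[i]^o) -> A)
    (x : unit_space G)
    (lam : A -> ell2 R (fiber x) -> ell2 R (fiber x)) : Prop :=
  star_representation lam /\
  forall a h, Cc a -> fiber x h ->
    lam (iota a) (ell2_delta (fiber x) h) =
    \sum_(g \in [set g | src g = rng h]) (a g *: ell2_delta (fiber x) (gmul g h)).

End ConvolutionAlgebra.

Section BorelModuloMeager.
Context {R : realType} {X : topologicalType}.

Definition nowhere_dense (Z : set X) : Prop := (closure Z)^° = set0.

Definition meager (Z : set X) : Prop :=
  exists F : nat -> set X,
    (forall n, nowhere_dense (F n)) /\ Z `<=` \bigcup_n F n.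

Lemma meager_sub (Z Z' : set X) : Z `<=` Z' -> meager Z' -> meager Z.
Proof. by move=> ZZ' [F [Fn FZ]]; exists F; split=> // x /ZZ' /FZ. Qed.

Lemma meager0 : meager set0.
Proof.
exists (fun=> set0); split=> [n|x []].
by rewrite /nowhere_dense closure0 interior0.
Qed.

Lemma meagerU (Z Z' : set X) : meager Z -> meager Z' -> meager (Z `|` Z').
Proof.
move=> [F [Fn FZ]] [F' [Fn' FZ']].
exists (fun n => if odd n then F n./2 else F' n./2); split=> [n|x].
  by case: odd.
case=> [/FZ[n _ Fx]|/FZ'[n _ Fx]].
- by exists n.*2.+1 => //=; rewrite odd_double/= uphalf_double.
- by exists n.*2 => //=; rewrite odd_double doubleK.
Qed.

Definition bounded_borel : set {uniform X -> R[i]^o} :=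
  [set f | (exists M : R[i], forall x, `|f x| <= M) /\
    forall U : set R[i]^o, open U -> <<s @open X >> (f @^-1` U)].

(* B_b(X), with the topology of the supremum norm. *)
Definition Bb : Type := set_type bounded_borel.
HB.instance Definition _ := Topological.on Bb.

Definition eq_mod_meager (f g : Bb) : bool :=
  `[< meager [set x | set_val f x != set_val g x] >].

Lemma eq_mod_meager_refl : reflexive eq_mod_meager.
Proof.
move=> f; apply/asboolP; apply: meager_sub meager0 => x /=.
by rewrite eqxx.
Qed.

Lemma eq_mod_meager_sym : symmetric eq_mod_meager.
Proof.
by move=> f g; apply/asboolP/asboolP; apply: meager_sub => x /=; rewrite eq_sym.
Qed.

Lemma eq_mod_meager_trans : transitive eq_mod_meager.
Proof.
move=> g f h /asboolP fg /asboolP gh; apply/asboolP.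
apply: meager_sub (meagerU fg gh) => x /= fh.
have [E|] := eqVneq (set_val f x) (set_val g x); last by left.
by right; rewrite /= -E.
Qed.

Canonical eq_mod_meager_equiv := EquivRel eq_mod_meager
  eq_mod_meager_refl eq_mod_meager_sym eq_mod_meager_trans.

(* B_b(X)/M(X): the quotient topology is that of the quotient norm. *)
Definition BbM : Type := quotient_topology {eq_quot eq_mod_meager}.
HB.instance Definition _ := Topological.on BbM.

Definition Bb_class (f : Bb) : BbM := \pi f.

Lemma bounded_borel0 : bounded_borel (fun=> 0).
Proof.
split; first by exists 0 => x; rewrite normr0.
move=> U _; have [U0|U0] := pselect (U 0).
- rewrite (_ : _ @^-1` _ = setT); last by apply/seteqP; split.
  by move=> B [[B0 BC _] _]; rewrite -(setD0 setT); exact: BC.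
- rewrite (_ : _ @^-1` _ = set0); last by apply/seteqP; split.
  by move=> B [[B0 _ _] _].
Qed.

Definition Bb0 : Bb := SigSub (mem_set bounded_borel0).

End BorelModuloMeager.
Arguments BbM R X : clear implicits.

Section EssentialAlgebra.
Context {R : realType} {G : topGroupoidType}.

(* [EL] is the continuous extension of a |-> [a|_X]. *)
Definition is_EL (A : cstarAlgType R) (iota : (G -> R[i]^o) -> A)
    (EL : A -> BbM R (unit_space G)) : Prop :=
  continuous EL /\
  forall a, Cc a -> exists2 f : Bb,
    (forall x : unit_space G, set_val f x = a (set_val x)) &
    EL (iota a) = Bb_class f.

(* [q : A -> B] is the quotient map of A = C*_max(G) onto B = C*_ess(G). *)
Definition is_Cess (A B : cstarAlgType R) (EL : A -> BbM R (unit_space G))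
    (q : A -> B) : Prop :=
  [/\ star_hom q, forall b, exists a, q a = b &
      forall a, q a = 0 <-> EL (cmul (cstar a) a) = Bb_class Bb0].

(* The direct sum of the spaces l^2(G x) over the non-dangerous units x. *)
Definition ess_space : Type :=
  hsum (fun x : set_type (@safe_units G) =>
    (ell2 R (fiber (set_val x)) : hilbertType R)).
HB.instance Definition _ := Hilbert.on ess_space.

Definition is_Lambda_ess (A : cstarAlgType R)
    (lam : forall x : unit_space G, A -> ell2 R (fiber x) -> ell2 R (fiber x))
    (Lam : A -> ess_space -> ess_space) : Prop :=
  star_representation Lam /\
  forall a (xi : ess_space) (x : set_type (@safe_units G)),
    hsum_val (Lam a xi) x = lam (set_val x) a (hsum_val xi x).

End EssentialAlgebra.
Arguments ess_space R G : clear implicits.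

(* Main.v *)
Require Import Defs.
From mathcomp Require Import all_boot all_order all_algebra.
From mathcomp Require Import all_classical all_reals all_analysis.
From mathcomp Require Import complex.
From mathcomp Require Import finmap generic_quotient lra.
Import Order.TTheory GRing.Theory Num.Theory.
Import numFieldNormedType.Exports.
Local Open Scope classical_set_scope.
Local Open Scope ring_scope.
Local Open Scope complex_scope.

(* Write [F_b(x) = <lambda_x(b) delta_x, delta_x>]; it is bounded by [|b|] and
   equals [b(x)] for [b] in Cc.  A function in Cc is continuous at every
   non-dangerous arrow, and the dangerous units lie on the boundaries in X of
   the traces on X of countably many bisections, hence form a meager set.

   If EL(a* a) = 0, approximate [a* a] by functions [c] in Cc: each [c] is small
   off a meager set, hence, by continuity and Baire's theorem, at every safe
   unit, so that [|lambda_x(a) delta_x|^2 = F_{a* a}(x) = 0] for safe [x].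
   Conversely, if [lambda_x(a) delta_x = 0] for all safe [x], the approximants
   are small off the meager set of dangerous units, and EL(a* a) = 0.

   For the other basis vectors, [delta_g = lambda_x(c) delta_x] when [c] is a
   bump function on a bisection through [g]; since the kernel of the quotient
   map is an ideal, it contains [a c] together with [a], so that
   [lambda_x(a) delta_g = lambda_x(a c) delta_x = 0].

   The direct sum exists because representations of C*-algebras are
   contractive. *)

(** * Norm and involution in a C*-algebra *)

Section CStarAlgebra.
Context {R : realType} {A : cstarAlgType R}.
Implicit Types a b x y w : A.

Lemma cmul_subl a b x : cmul (a - b) x = cmul a x - cmul b x.
Proof. by rewrite cmulDl -scaleN1r cmulZl scaleN1r. Qed.

Lemma cmul_subr a b x : cmul x (a - b) = cmul x a - cmul x b.
Proof. by rewrite cmulDr -scaleN1r cmulZr scaleN1r. Qed.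

Lemma cstar_sub a b : cstar (a - b) = cstar a - cstar b.
Proof.
by rewrite cstarD -[- b]scaleN1r cstarZ rmorphN rmorph1 scaleN1r.
Qed.

Lemma cstar0 : cstar (0 : A) = 0.
Proof. by rewrite -[X in cstar X](subrr 0) cstar_sub subrr. Qed.

Lemma rnorm_cmul a b : rnorm (cmul a b) <= rnorm a * rnorm b.
Proof. by have := cnormM a b; rewrite !rnormE -rmorphM/= lecR. Qed.

Lemma rnorm_cstar_cmul a : rnorm (cmul (cstar a) a) = rnorm a ^+ 2.
Proof.
have := cnorm_star a; rewrite !rnormE -rmorphXn/=.
by move=> /(congr1 (@complex.Re R)).
Qed.

(** The C*-identity and submultiplicativity give [|b|^2 <= |cstar b| |b|]; cancel [|b|], and use the
    result for both [a] and [cstar a]. *)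
Lemma rnorm_cstar a : rnorm (cstar a) = rnorm a.
Proof.
have le b : rnorm b <= rnorm (cstar b).
  have := rnorm_cmul (cstar b) b; rewrite rnorm_cstar_cmul expr2.
  have [->|b0] := eqVneq (rnorm b) 0; first by rewrite rnorm_ge0.
  by rewrite ler_pM2r// lt_neqAle eq_sym b0 rnorm_ge0.
by apply/le_anti; rewrite le andbT -{2}(cstarK a) le.
Qed.

End CStarAlgebra.

Lemma conj_realC {R : realType} (t : R) : Num.conj (t%:C : R[i]) = t%:C.
Proof. exact: conjc_real. Qed.

Section RealScaling.
Context {R : realType} {V : normedModType R[i]}.

Lemma rnormZr (t : R) (x : V) : 0 <= t -> rnorm (t%:C *: x) = t * rnorm x.
Proof.
by move=> t0; rewrite rnormZ /= expr0n addr0 sqrtr_sqr ger0_norm.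
Qed.

Lemma halfD (x : V) : (2^-1)%:C *: (x + x) = x.
Proof.
rewrite -mulr2n -(scaler_nat 2 x) scalerA (fmorphV (real_complex R)).
by rewrite (rmorph_nat (real_complex R) 2) mulVf ?scale1r// pnatr_eq0.
Qed.

End RealScaling.

(** * Square roots of [1 - x] without a unit *)

Section SquareRoot.
Context {R : realType} {A : cstarAlgType R}.
Variables (x : A) (r : R).
Hypotheses (xr : rnorm x <= r) (r1 : r < 1) (xsa : cstar x = x).

Let r0 : 0 <= r. Proof. exact: le_trans (rnorm_ge0 x) xr. Qed.
Let f (w : A) := (2^-1)%:C *: (x + cmul w w).

(** From [v v - w w = v (v - w) + (v - w) w]: each term contributes at most [r |v - w|], and the
    factor [1/2] in [f] absorbs the two. *)
Let f_dist (v w : A) : rnorm v <= r -> rnorm w <= r ->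
  rnorm (f v - f w) <= r * rnorm (v - w).
Proof.
move=> vr wr; rewrite /f -scalerBr opprD addrACA subrr add0r rnormZr ?invr_ge0//.
rewrite (_ : cmul v v - _ = cmul v (v - w) + cmul (v - w) w).
  have := rnormD (cmul v (v - w)) (cmul (v - w) w).
  have := rnorm_cmul v (v - w); have := rnorm_cmul (v - w) w.
  have := ler_wpM2r (rnorm_ge0 (v - w)) vr.
  have := ler_wpM2l (rnorm_ge0 (v - w)) wr.
  rewrite (mulrC _ r); lra.
by rewrite cmul_subl cmul_subr addrA subrK.
Qed.

Let f_ball (w : A) : rnorm w <= r -> rnorm (f w) <= r.
Proof.
move=> wr; rewrite /f rnormZr ?invr_ge0//.
have := rnormD x (cmul w w); have := rnorm_cmul w w.
have := ler_pM (rnorm_ge0 w) (rnorm_ge0 w) wr wr.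
have : r * r <= r by rewrite ler_piMr// ltW.
move: xr; lra.
Qed.

Let u n := iter n f 0.

Let u_ball n : rnorm (u n) <= r.
Proof. by elim: n => [|n IH]; [rewrite rnorm0|exact: f_ball]. Qed.

Let u_sa n : cstar (u n) = u n.
Proof.
elim: n => [|n IH]; first exact: cstar0.
by rewrite /u /= -/(u n) /f cstarZ cstarD cstarM xsa IH conj_realC.
Qed.

(** Each application of the contraction [f] gains a factor [r], starting from [|u 0 - u k| <= r]. *)
Let u_dist n k : rnorm (u n - u (n + k)) <= r ^+ n.
Proof.
suff : rnorm (u n - u (n + k)) <= r ^+ n * r.
  by move=> /le_trans; apply; rewrite ler_piMr ?exprn_ge0// ltW.
elim: n => [|n IH]; first by rewrite add0r rnormN expr0 mul1r u_ball.
rewrite exprS -mulrA; apply: le_trans (ler_wpM2l r0 IH).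
exact: f_dist.
Qed.

(* [1 - w] is a self-adjoint square root of [1 - x], as the limit of the
   iteration [w := (x + w^2) / 2], a contraction on the ball of radius [r]. *)
Lemma sqrt_one_minus :
  exists w : A, cstar w = w /\ w + w = x + cmul w w.
Proof.
have rn_small e : 0 < e -> exists N, forall n, (N <= n)%N -> r ^+ n < e.
  move=> e0; have : geometric 1 r @ \oo --> (0 : R).
    by apply: cvg_geometric; rewrite ger0_norm.
  move=> /cvgrPdist_lt/(_ _ e0)[N _ hN]; exists N => n /hN.
  by rewrite /geometric /= mul1r sub0r normrN ger0_norm ?exprn_ge0.
have : cvg (u @ \oo).
  apply: cauchy_cvg; apply: cauchy_exP => e e0.
  have [eE re0] := gt0_realC e0.
  have [N hN] := rn_small _ re0; exists (u N); exists N => // n /= Nn.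
  rewrite -ball_normE /ball_ /= eE ltr_rnorm -(subnKC Nn).
  exact: le_lt_trans (u_dist _ _) (hN N _).
move=> /cvg_ex[w uw].
have close e : 0 < e -> exists n, rnorm (w - u n) < e /\ rnorm (w - u n.+1) < e.
  move=> e0; have e0' : 0 < e%:C by rewrite ltcR.
  have /cvgrPdist_lt/(_ _ e0')[N _ hN] := uw.
  by exists N; split; rewrite -ltr_rnorm; apply: hN => //=.
(* Dividing by [c + 1] instead of [c] covers the case [c = 0]. *)
have small (y : A) (c : R) :
    (forall e, 0 < e -> rnorm y <= c * e) -> 0 <= c -> y = 0.
  move=> yc c0; apply: rnorm_eq0; apply/le_anti; rewrite rnorm_ge0 andbT.
  apply/ler_addgt0Pl => e e0; rewrite addr0.
  apply: le_trans (yc (e / (c + 1)) _) _; first by rewrite divr_gt0// ltr_wpDl.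
  by rewrite mulrCA ler_piMr ?(ltW e0)// ler_pdivrMr ?ltr_wpDl// mul1r lerDl.
have wr : rnorm w <= r.
  apply/ler_addgt0Pl => e e0; have [n [wn _]] := close _ e0.
  by have := rnormD (w - u n) (u n); rewrite subrK; have := u_ball n; lra.
exists w; split.
  apply/eqP; rewrite -subr_eq0; apply/eqP; apply: (small _ 2) => // e e0.
  have [n [wn _]] := close _ e0.
  have -> : cstar w - w = cstar (w - u n) - (w - u n).
    by rewrite cstar_sub u_sa opprB addrA subrK.
  have := rnormD (cstar (w - u n)) (- (w - u n)).
  by rewrite rnormN rnorm_cstar; lra.
have fw : w = f w.
  apply/eqP; rewrite -subr_eq0; apply/eqP; apply: (small _ 2) => // e e0.
  have [n [wn wn1]] := close _ e0.
  have -> : w - f w = (w - u n.+1) + (f (u n) - f w) by rewrite addrA subrK.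
  apply: le_trans (rnormD _ _) _.
  have := f_dist _ _ (u_ball n) wr; rewrite -[rnorm (u n - w)]rnormN opprB.
  have := ler_wpM2r (rnorm_ge0 (w - u n)) (ltW r1); lra.
by rewrite [in LHS]fw /f -scalerDr halfD.
Qed.

End SquareRoot.

(** * Representations of C*-algebras are contractive *)

Section Representation.
Context {R : realType} {A : cstarAlgType R} {H : hilbertType R}.
Context { pi : A -> H -> H}.
Hypothesis pi_rep : star_representation pi.

Lemma rep0 xi : pi 0 xi = 0.
Proof.
case: pi_rep => _ /(_ 1 0 0 xi) + _ _; rewrite !scale1r addr0 => h.
by apply: (@addrI _ (pi 0 xi)); rewrite -h addr0.
Qed.

Lemma repD a b xi : pi (a + b) xi = pi a xi + pi b xi.
Proof. by case: pi_rep => _ /(_ 1 a b xi); rewrite !scale1r. Qed.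

Lemma repZ (c : R[i]) a xi : pi (c *: a) xi = c *: pi a xi.
Proof.
by case: pi_rep => _ /(_ c a 0 xi) + _ _; rewrite rep0 !addr0.
Qed.

Lemma repB a b xi : pi (a - b) xi = pi a xi - pi b xi.
Proof. by rewrite repD -scaleN1r repZ scaleN1r. Qed.

Lemma repM a b xi : pi (cmul a b) xi = pi a (pi b xi).
Proof. by case: pi_rep. Qed.

Lemma rep_adj a xi eta : hip (pi a xi) eta = hip xi (pi (cstar a) eta).
Proof. by case: pi_rep. Qed.

Lemma rep_linear a : linear (pi a).
Proof. by case: pi_rep => /(_ a)[]. Qed.

Lemma rep_vec0 a : pi a 0 = 0.
Proof.
have := rep_linear a 1 0 0; rewrite !scale1r addr0 => h.
by apply: (@addrI _ (pi a 0)); rewrite -h addr0.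
Qed.

(* The square root [1 - w] of [1 - x] gives
   [0 <= |xi - pi w xi|^2 = <pi (1 - x) xi, xi>]. *)
Lemma rep_le_id (x : A) (xi : H) : cstar x = x -> rnorm x < 1 ->
  complex.Re (hip (pi x xi) xi) <= rnorm xi ^+ 2.
Proof.
move=> xsa x1; have [w [wsa ww]] := sqrt_one_minus _ _ (lexx _) x1 xsa.
have := sqr_ge0 (rnorm (- pi w xi + xi)); rewrite hip_rnormD rnormN.
(* As [w] is self-adjoint, [|pi w xi|^2 = <pi (w w) xi, xi>], and [w w = w + w - x]. *)
have -> : rnorm (pi w xi) ^+ 2 = complex.Re (hip (pi w xi) xi) *+ 2 -
    complex.Re (hip (pi x xi) xi).
  have /(congr1 (@complex.Re R)) := hip_rnorm (pi w xi) => /= <-.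
  rewrite -{2}wsa -rep_adj -repM mulr2n -!raddfD -raddfB -!hipDl -repD ww.
  by congr complex.Re; rewrite repD hipDl addrC addKr.
rewrite -[- pi w xi]scaleN1r hipZl mulN1r raddfN/=; lra.
Qed.

(** Since [|pi a xi|^2 = <pi (cstar a a) xi, xi>], apply [rep_le_id] to [cstar a a], rescaled to
    have norm below 1. *)
Lemma rep_contractive a xi : rnorm (pi a xi) <= rnorm a * rnorm xi.
Proof.
rewrite -ler_sqr ?nnegrE ?mulr_ge0 ?rnorm_ge0// exprMn.
apply/ler_addgt0Pl => e e0.
have [xi0|xi0] := eqVneq (rnorm xi) 0.
  by rewrite (rnorm_eq0 xi0) rep_vec0 rnorm0 expr0n mulr0 addr0 ltW.
have X : 0 < rnorm xi ^+ 2 by rewrite exprn_gt0// lt_neqAle eq_sym xi0 rnorm_ge0.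
(* This [t] exceeds [|a|^2], and [t |xi|^2] exceeds the desired bound by exactly [e]. *)
set t := rnorm a ^+ 2 + e / rnorm xi ^+ 2.
have t0 : 0 < t by rewrite ltr_wpDl ?sqr_ge0 ?divr_gt0.
have := @rep_le_id ((t^-1)%:C *: cmul (cstar a) a) xi.
rewrite rnormZr ?invr_ge0 ?(ltW t0)// rnorm_cstar_cmul.
rewrite cstarZ conj_realC cstarM cstarK.
have lt1 : t^-1 * rnorm a ^+ 2 < 1.
  by rewrite ltr_pdivrMl// mulr1 /t ltrDl divr_gt0.
move=> /(_ erefl lt1); rewrite repZ hipZl repM rep_adj cstarK.
rewrite hip_rnorm -rmorphM/=.
by rewrite ler_pdivrMl// /t mulrDl mulfVK ?gt_eqF// addrC.
Qed.

End Representation.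

Lemma hip0r {R : realType} {H : hilbertType R} (x : H) : hip x 0 = 0.
Proof. by rewrite -[X in hip _ X](scale0r 0) hipZr rmorph0 mul0r. Qed.

Section SingleTerm.
Context {R : realType} {I : choiceType}.

Lemma rsum_single (f : I -> R) i0 : (forall i, i != i0 -> f i = 0) ->
  rsum f = f i0.
Proof.
move=> f0; rewrite {1}/rsum.
have key (g : I -> R) : (forall i, 0 <= g i) ->
    (forall i, i != i0 -> g i = 0) -> rsum0 g = g i0.
  move=> g0 gi0; have sumE (B : {fset I}) : \sum_(i <- B) g i <= g i0.
    have [iB|iB] := boolP (i0 \in B).
      rewrite (bigD1_seq i0)//= big1 ?addr0// => i /gi0; exact.
    rewrite big_seq big1 ?g0// => i iB'; apply: gi0.
    by apply: contraNneq iB => <-.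
  apply/le_anti; rewrite rsum0_le//=.
  have := @le_rsum0 _ _ g [fset i0]%fset g0 (summ_le sumE).
  by rewrite big_seq_fset1.
rewrite !key.
- by case: (lerP (f i0) 0) => h; case: (lerP (- f i0) 0) => h'; lra.
- by move=> i; rewrite le_max lexx orbT.
- by move=> i /f0 ->; rewrite oppr0 maxxx.
- by move=> i; rewrite le_max lexx orbT.
- by move=> i /f0 ->; rewrite maxxx.
Qed.

Lemma csum_single (f : I -> R[i]) i0 : (forall i, i != i0 -> f i = 0) ->
  csum f = f i0.
Proof.
move=> f0; rewrite /csum !(@rsum_single _ i0); last 2 first.
- by move=> i /f0 ->.
- by move=> i /f0 ->.
by case: (f i0).
Qed.

End SingleTerm.

(** * Coordinates with respect to the basis of [ell2] *)

Section Ell2Basis.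
Context {R : realType} {T : choiceType} {S : set T}.

Lemma ell2_delta_coord (s t : set_type S) :
  ell2_delta S (set_val s) t = (if t == s then 1 else 0) :> R[i].
Proof.
rewrite /= /delta_fun !set_valE.
have [->|ts] := eqVneq t s; first by rewrite eqxx.
by case: eqP => // /val_inj ts'; rewrite ts' eqxx in ts.
Qed.

Lemma hip_ell2_delta (x : ell2 R S) (s : set_type S) :
  hip x (ell2_delta S (set_val s)) = x s.
Proof.
have E i : hip (x i) (ell2_delta S (set_val s) i) =
    (x i : R[i]) * Num.conj (if i == s then 1 else 0 : R[i]).
  by rewrite -ell2_delta_coord.
rewrite [LHS](_ : _ = csum (fun i => hip (x i) (ell2_delta S (set_val s) i)))//.
rewrite (@csum_single _ _ _ s) => [|i /negbTE ne]; rewrite E.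
- by rewrite eqxx rmorph1 mulr1.
- by rewrite ne rmorph0 mulr0.
Qed.

(** The coordinates of [rho (cstar a) eta] are [<eta, rho a delta_s> = 0]; hence [|rho a xi|^2 =
    <xi, rho (cstar a) (rho a xi)> = 0]. Going through the adjoint replaces a density argument for
    the span of the basis. *)
Lemma ell2_rep_eq0 {A : cstarAlgType R} {rho : A -> ell2 R S -> ell2 R S} a :
  star_representation rho ->
  (forall s : set_type S, rho a (ell2_delta S (set_val s)) = 0) ->
  forall xi, rho a xi = 0.
Proof.
move=> rr a0.
have adj0 eta : rho (cstar a) eta = 0.
  by apply: hsum_ext => s; rewrite -hip_ell2_delta (rep_adj rr) cstarK a0 hip0r.
move=> xi; apply: rnorm_eq0; apply/eqP; rewrite -sqrf_eq0.
have /(congr1 (@complex.Re R)) := hip_rnorm (rho a xi).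
by rewrite (rep_adj rr) adj0 hip0r /= => <-.
Qed.

End Ell2Basis.

Lemma linear_bounded_continuous {R : realType} {V W : normedModType R[i]}
    {f : V -> W} {M : R} : linear f ->
  (forall x, rnorm (f x) <= M * rnorm x) -> continuous f.
Proof.
move=> lin fM x; apply/cvgrPdist_lt => e /gt0_realC[-> e0].
near=> y.
have -> : f x - f y = f (x - y).
  have := lin (-1) y x; rewrite !scaleN1r addrC => <-.
  by congr f; rewrite addrC.
rewrite ltr_rnorm; apply: le_lt_trans (fM _) _.
(* The sign of [M] is arbitrary; [|M| + 1] is a positive bound to divide by. *)
apply: (@le_lt_trans _ _ ((`|M| + 1) * rnorm (x - y))).
  by rewrite ler_wpM2r ?rnorm_ge0// (le_trans (ler_norm M))// lerDl.
rewrite -ltr_pdivlMl ?ltr_wpDl// mulrC -ltr_rnorm.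
near: y; apply: cvgr_dist_lt => //.
by rewrite ltcR divr_gt0// ltr_wpDl.
Unshelve. all: by end_near. Qed.

(** * Direct sums of representations *)

Section DirectSum.
Context {R : realType} {I : choiceType} {H : I -> hilbertType R}.
Context {A : cstarAlgType R} {rho : forall i, A -> H i -> H i}.
Hypothesis rho_rep : forall i, star_representation (rho i).

(** Contractivity supplies the bound [|a|], uniform in [i], that makes the family square
    summable. *)
Lemma summ_direct_sum a (xi : hsum H) :
  summ (sqnorm (fun i => rho i a (xi i))).
Proof.
apply: summ_mono (summZ (sqr_ge0 (rnorm a)) (sqnorm_ge0 _) (hsum_summ xi)) => i.
rewrite /sqnorm -exprMn ler_sqr ?nnegrE ?mulr_ge0 ?rnorm_ge0//.
exact: rep_contractive.
Qed.

Definition direct_sum_rep a (xi : hsum H) : hsum H :=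
  HSum (summ_direct_sum a xi).

Lemma direct_sum_rep_le a xi :
  rnorm (direct_sum_rep a xi) <= rnorm a * rnorm xi.
Proof.
rewrite -ler_sqr ?nnegrE ?mulr_ge0 ?rnorm_ge0// exprMn !hsum_rnormE.
rewrite !hsum_rnorm_sq -rsum0Z ?sqr_ge0//; last 2 first.
- exact: sqnorm_ge0.
- exact: hsum_summ.
apply: rsum0_mono; first exact: sqnorm_ge0.
- move=> i; rewrite /sqnorm -exprMn ler_sqr ?nnegrE ?mulr_ge0 ?rnorm_ge0//.
  exact: rep_contractive.
- by apply: summZ (hsum_summ xi); [exact: sqr_ge0|exact: sqnorm_ge0].
Qed.

Lemma direct_sum_rep_star : star_representation direct_sum_rep.
Proof.
split=> [a|c a b xi|a b xi|a xi eta].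
- have lin : linear (direct_sum_rep a).
    move=> c xi eta; apply: hsum_ext => i /=; exact: (rep_linear (rho_rep i)).
  by split=> //; exact: linear_bounded_continuous lin (direct_sum_rep_le a).
- by apply: hsum_ext => i /=; rewrite (repD (rho_rep i)) (repZ (rho_rep i)).
- by apply: hsum_ext => i /=; rewrite (repM (rho_rep i)).
- rewrite [LHS](_ : _ = csum (fun i => hip (rho i a (xi i)) (eta i)))//.
  rewrite [RHS](_ : _ = csum (fun i => hip (xi i) (rho i (cstar a) (eta i))))//.
  by congr csum; apply/funext => i; rewrite (rep_adj (rho_rep i)).
Qed.

(** Vectors concentrated in one summand recover each [rho i] from the direct sum. *)
Lemma hsum_single_subproof i (v : H i) :
  summ (sqnorm (dfwith (fun j => 0 : H j) i v)).
Proof.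
apply: (@summ_le _ _ _ (rnorm v ^+ 2)) => B.
have z j : j != i -> sqnorm (dfwith (fun j => 0 : H j) i v) j = 0.
  by move=> ji; rewrite /sqnorm dfwithout 1?eq_sym// rnorm0 expr0n.
have [iB|iB] := boolP (i \in B).
  by rewrite (bigD1_seq i)//= big1 => [|j /z//]; rewrite /sqnorm dfwithin addr0.
rewrite big_seq big1 ?sqr_ge0// => j jB; apply: z.
by apply: contraNneq iB => <-.
Qed.

Lemma direct_sum_rep_eq0 a : (forall xi, direct_sum_rep a xi = 0) ->
  forall i v, rho i a v = 0.
Proof.
move=> a0 i v.
have := congr1 (fun x : hsum H => x i) (a0 (HSum (hsum_single_subproof i v))).
by rewrite /= dfwithin.
Qed.

End DirectSum.

(** * Topology of subspaces given as subtypes *)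

Section SubtypeTopology.
Context {T : topologicalType} {S : set T}.

Definition sub_point {x : T} (Sx : S x) : set_type S := SigSub (mem_set Sx).

Lemma set_val_inj : injective (set_val : set_type S -> T).
Proof. by move=> x y; rewrite !set_valE => /val_inj. Qed.

Lemma set_val_continuous : continuous (set_val : set_type S -> T).
Proof. exact: (@initial_continuous _ _ (set_val : set_type S -> T)). Qed.

Lemma nbhs_set_typeP (x : set_type S) (V : set (set_type S)) :
  nbhs x V <-> exists2 W, nbhs (set_val x) W & set_val @^-1` W `<=` V.
Proof.
split=> [[_ [/= [W oW <-] Wx WV]]|[W xW WV]].
  by exists W => //; exact: open_nbhs_nbhs.
by apply: filterS WV _; exact: set_val_continuous.
Qed.

(** Push a filter forward along [set_val]; since [set_val] is an embedding, a cluster point of the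
    image comes from one upstairs. *)
Lemma compact_set_val (K : set (set_type S)) :
  compact (set_val @` K) -> compact K.
Proof.
move=> cK F FF FK.
have [_ [[x Kx <-] Fx]] : (set_val @` K `&` cluster (set_val @ F)) !=set0.
  by apply: cK; apply: (@filterS _ F _ _ _ _ FK) => x Kx; exists x.
exists x; split=> // C B FC /nbhs_set_typeP[W xW WB].
have [_ [[y Cy <-] Wy]] : (set_val @` C `&` W) !=set0.
  by apply: Fx xW; apply: (@filterS _ F _ _ _ _ FC) => y Cy; exists y.
by exists y; split=> //; exact: WB.
Qed.

Lemma continuous_set_val_at {Y : topologicalType} (f : T -> Y) (x : T) :
  open S -> S x -> continuous (fun y : set_type S => f (set_val y)) ->
  {for x, continuous f}.
Proof.
move=> oS Sx fS; have : {within S, continuous f}.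
  exact/subspace_sigL_continuousP.
by rewrite continuous_open_subspace// => /(_ x); apply; exact: mem_set.
Qed.

End SubtypeTopology.

(** * Groupoid identities, dangerous arrows and étale groupoids *)

Section GroupoidAlgebra.
Context {G : topGroupoidType}.
Implicit Types g h : G.

Lemma src_src g : src (src g) = src g.
Proof. by rewrite /src gmul_src ?ginvK. Qed.

Lemma rng_src g : rng (src g) = src g.
Proof. by rewrite /src /rng gmul_rng ?ginvK. Qed.

Lemma gmul_srcr g : gmul g (src g) = g.
Proof. by rewrite -{1}[g]ginvK /src gmulKV ?ginvK. Qed.

Lemma src_unit (x : unit_space G) : src (set_val x) = set_val x.
Proof. by have [g _ E] := set_valP x; rewrite set_valE -E; exact: src_src. Qed.

Lemma rng_unit (x : unit_space G) : rng (set_val x) = set_val x.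
Proof. by have [g _ E] := set_valP x; rewrite set_valE -E; exact: rng_src. Qed.

Lemma src_in_units g : units G (src g).
Proof. by exists g. Qed.

Definition src_unit_space g : unit_space G := sub_point (src_in_units g).

Lemma src_unit_spaceE g : set_val (src_unit_space g) = src g.
Proof. by []. Qed.

Lemma fiber_unit (x : unit_space G) : fiber x (set_val x).
Proof. exact: src_unit. Qed.

Lemma bisection_src_inj (s : set G) g h : open_bisection s -> s g -> s h ->
  src g = src h -> g = h.
Proof.
by move=> [_ [_ _ _ [f' f'K _]] _] sg sh E; rewrite -(f'K g sg) -(f'K h sh) E.
Qed.

End GroupoidAlgebra.

Section Dangerous.
Context {G : topGroupoidType}.
Implicit Types g h : G.

(** Trades nets for cluster points. Conversely, the net is indexed by pairs of neighbourhoods of [g]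
    and [h], ordered by reverse inclusion, and picks a point in each intersection. *)
Lemma dangerousP g : dangerous g <-> exists h, h <> g /\ cluster (nbhs g) h.
Proof.
split=> [[I [le [u [h [[_ lexx letr ledir] hg ug uh]]]]]|[h [hg gh]]].
  exists h; split=> // U V /ug[i iU] /uh[j jV].
  have [k [ik jk]] := ledir i j.
  by exists (u k); split; [exact: iU|exact: jV].
pose I := {UV : set G * set G | nbhs g UV.1 /\ nbhs h UV.2}.
pose pt U V (gU : nbhs g U) (hV : nbhs h V) : I :=
  exist (fun UV => nbhs g UV.1 /\ nbhs h UV.2) (U, V) (conj gU hV).
have wit (i : I) : exists k, ((sval i).1 `&` (sval i).2) k.
  by case: i => -[U V] [/= gU hV]; exact: gh.
pose u i := sval (cid (wit i)).
have uP i : ((sval i).1 `&` (sval i).2) (u i) by exact: svalP (cid (wit i)).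
exists I, (fun i j => (sval j).1 `<=` (sval i).1 /\ (sval j).2 `<=` (sval i).2).
exists u, h; split=> //.
- split.
  + by constructor; exists (setT, setT); split; exact: filterT.
  + by move=> i; split.
  + move=> i j k [a b] [c d].
    by split; [exact: subset_trans a|exact: subset_trans b].
  + move=> [[U V] [/= gU hV]] [[U' V'] [/= gU' hV']].
    by exists (pt _ _ (filterI gU gU') (filterI hV hV')); split; split=> /= x [].
- move=> U gU; exists (pt _ _ gU filterT) => i [iU _]; apply: iU.
  by case: (uP i).
- move=> U hU; exists (pt _ _ filterT hU) => i [_ iU]; apply: iU.
  by case: (uP i).
Qed.

End Dangerous.

Section Meager.
Context {X : topologicalType}.

(** The boundary is closed, and an interior point of it would be adherent to [U] and have a
    neighbourhood disjoint from [U]. *)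
Lemma nowhere_dense_boundary (U : set X) : open U ->
  nowhere_dense (closure U `\` U).
Proof.
move=> oU; have cl : closed (closure U `\` U).
  by apply: closedI; [exact: closed_closure|exact: open_closedC].
rewrite /nowhere_dense -((closure_id _).1 cl); apply/seteqP; split=> // x /= xB.
have [cUx _] := interior_subset xB.
by have [y [Uy []]] := cUx _ xB.
Qed.

End Meager.

Section Etale.
Context {G : topGroupoidType}.
Hypothesis etaleG : etale G.
Implicit Types g h : G.

Lemma etale_bisection g : exists2 s : set G, open_bisection s & s g.
Proof. by have [s [bs sg _]] := etaleG g [set: G] openT I; exists s. Qed.

Lemma src_continuous : continuous (src : G -> G).
Proof.
move=> g; have [s bs sg] := etale_bisection g.
have [os [_ _ cs _] _] := bs.
by move: cs; rewrite continuous_open_subspace// => /(_ g); apply; exact: mem_set.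
Qed.

Lemma src_unit_space_continuous : continuous (@src_unit_space G).
Proof.
move=> g V /nbhs_set_typeP[W gW WV]; apply: filterS WV _.
exact: src_continuous gW.
Qed.

(** For [g] near [x], both [g] and [src g] lie in one bisection and have the same source, so
    [src g = g]. *)
Lemma nbhs_units (x : unit_space G) : nbhs (set_val x) (units G).
Proof.
have [s bs sx] := etale_bisection (set_val x); have [os _ _] := bs.
have xs : nbhs (set_val x) s by exact: open_nbhs_nbhs.
have : nbhs (set_val x) (src @^-1` s).
  by apply: src_continuous; rewrite src_unit.
apply: filterS2 xs => g sg ssg; exists g => //.
by apply: (bisection_src_inj _ _ _ bs) => //; rewrite src_src.
Qed.

Hypothesis hausX : hausdorff_space (unit_space G).

(* A unit [x] adherent to an arrow [h <> x] of [s_n] lies on the boundary of the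
   open set [s_n] restricted to X: it is a limit of units of [s_n], whose sources
   also tend to [src h], so that [src h = x] and [x] itself is not in [s_n]. *)
Lemma dangerous_units_meager :
  (exists s : nat -> set G,
    (forall n, open_bisection (s n)) /\ \bigcup_n s n = [set: G]) ->
  meager [set x : unit_space G | dangerous (set_val x)].
Proof.
move=> [s [bs sG]].
pose U n : set (unit_space G) := set_val @^-1` s n.
have oU n : open (U n).
  have [os _ _] := bs n; move/continuousP: (@set_val_continuous G (units G)).
  exact.
exists (fun n => closure (U n) `\` U n); split.
  by move=> n; exact: nowhere_dense_boundary.
move=> x /dangerousP[h [hx xh]].
have [n _ snh] : (\bigcup_n s n) h by rewrite sG.
have hs : nbhs h (s n) by have [os _ _] := bs n; exact: open_nbhs_nbhs.
(* Units form a neighbourhood of [x], so the points witnessing adherence may be taken to be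
   units. *)
have near_xh (V W : set G) : nbhs (set_val x) V -> nbhs h W ->
    exists y : unit_space G, V (set_val y) /\ W (set_val y).
  move=> xV hW; have [g [[Vg ug] Wg]] := xh _ _ (filterI xV (nbhs_units x)) hW.
  by exists (sub_point ug).
exists n => //; split=> [V /nbhs_set_typeP[W xW WV]|sx].
  have [y [Wy sy]] := near_xh _ _ xW hs.
  by exists y; split=> //; exact: WV.
apply: hx; apply: (bisection_src_inj _ _ _ (bs n)) => //; rewrite src_unit.
rewrite -src_unit_spaceE; congr set_val; apply: esym; apply: hausX.
move=> A B /nbhs_set_typeP[V xV VA] hB.
have [y [Vy By]] := near_xh _ _ xV (src_unit_space_continuous h B hB).
exists y; split; first exact: VA.
by rewrite (_ : y = src_unit_space (set_val y))//; apply: set_val_inj;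
  rewrite src_unit_spaceE src_unit.
Qed.

End Etale.

(** * Functions in [Cc]: continuity, finite fibres, action on [delta_x] *)

Section CcFunctions.
Context {R : realType} {G : topGroupoidType}.
Implicit Types (a f : G -> R[i]^o) (g h : G).

(* Where continuity fails, [g] is not in [s] and is adherent to the compact
   support of [f], so that it has a second limit point there, inside [s]. *)
Lemma bisection_function_continuous f g :
  bisection_function f -> ~ dangerous g -> {for g, continuous f}.
Proof.
move=> [s [[os _ _] fs fs']].
set S := closure _ => cS ng.
have [sg|nsg] := pselect (s g).
  exact: (continuous_set_val_at f g os sg fs').
suff f0 : nbhs g [set h | f h = 0].
  rewrite /prop_for /continuous_at (fs g nsg) => V V0.
  by apply: filterS f0 => h /= fh; rewrite fh; exact: (nbhs_singleton V0).
apply: contrapT => nf0; apply: ng; apply/dangerousP.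
(* The trace of the neighbourhood filter of [g] on the set where [f] is nonzero; it is proper
   because [f] does not vanish near [g]. *)
pose F : set_system G := fun V => nbhs g [set h | f h != 0 -> V h].
have FF : ProperFilter F.
  split; last split.
  - move=> F0; apply: nf0; rewrite /F in F0.
    apply: (filterS _ F0) => h /= h0.
    by apply: contrapT => /eqP /h0.
  - by rewrite /F; apply: filterE.
  - move=> P Q; rewrite /F; apply: filterS2 => h hP hQ h0.
    by split; [exact: hP|exact: hQ].
  - by move=> P Q PQ; rewrite /F; apply: filterS => h hP h0; exact/PQ/hP.
have cK : compact (set_val @` S).
  apply: continuous_compact cS; apply: continuous_subspaceT.
  exact: set_val_continuous.
have FK : F (set_val @` S).
  rewrite /F; apply: filterE => h h0.
  have sh : s h by apply: contrapT => /fs fh; rewrite fh eqxx in h0.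
  by exists (sub_point sh) => //; exact: subset_closure.
have [h [[t _ th] Fh]] := cK F FF FK.
exists h; split.
  by move=> hg; apply: nsg; rewrite -hg -th; exact: set_mem (valP t).
by move=> U V gU hV; apply: Fh => //; rewrite /F; apply: filterS gU => k Uk _.
Qed.

Lemma Cc_continuous a g : Cc a -> ~ dangerous g -> {for g, continuous a}.
Proof.
move=> [n [c [f [fb ->]]]] ng.
have -> : \sum_(i < n) c i *: f i = fun h => \sum_(i < n) c i *: f i h.
  by apply/funext => h; rewrite fct_sumE.
rewrite /prop_for /continuous_at; elim: (index_enum _) => [|i r IH].
  by under eq_fun do rewrite big_nil; rewrite big_nil; exact: cvg_cst.
under eq_fun do rewrite big_cons; rewrite big_cons; apply: cvgD IH.
by apply: cvgZr; exact: bisection_function_continuous.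
Qed.

Lemma bisection_function_finite_fiber f g :
  bisection_function f -> finite_set [set h | src h = src g /\ f h != 0].
Proof.
move=> [s [bs fs _ _]].
have sub : [set h | src h = src g /\ f h != 0] `<=`
    [set h | src h = src g /\ s h].
  move=> h [hg h0]; split=> //.
  by apply: contrapT => /fs fh; rewrite fh eqxx in h0.
apply: sub_finite_set sub _.
have [[k [kg sk]]|no] := pselect (exists k, src k = src g /\ s k).
  apply: (@sub_finite_set _ _ [set k]) (finite_set1 k) => h [hg sh] /=.
  by apply: (bisection_src_inj _ _ _ bs) => //; rewrite kg.
apply: (@sub_finite_set _ _ set0) (finite_set0 _) => h hs; apply: no.
by exists h.
Qed.

(** A bisection meets a fibre of [src] in at most one arrow. Finiteness matters because a sum with
    infinite support is 0 by default. *)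
Lemma Cc_finite_fiber a g :
  Cc a -> finite_set [set h | src h = src g /\ a h != 0].
Proof.
move=> [n [c [f [fb ->]]]].
apply: (@sub_finite_set _ _
    (\bigcup_(i in [set: 'I_n]) [set h | src h = src g /\ f i h != 0])).
  move=> h [hg]; rewrite fct_sumE => h0.
  have [[i fi0]|no] := pselect (exists i, f i h != 0); first by exists i.
  exfalso; move/eqP: h0; apply; rewrite big1// => i _.
  rewrite -[LHS]/(c i *: f i h).
  by have [->|fi0] := eqVneq (f i h) 0; [rewrite scaler0|case: no; exists i].
apply: bigcup_finite => // i _; exact: bisection_function_finite_fiber.
Qed.

Lemma hsum_sum_coord {I J : choiceType} {H : I -> hilbertType R} (r : seq J)
    (F : J -> hsum H) i : (\sum_(j <- r) F j : hsum H) i = \sum_(j <- r) F j i.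
Proof. by elim: r => [|j r IH]; rewrite ?big_nil// !big_cons -IH. Qed.

(** Since [h x = h] when [src h = x], each term lands in its own coordinate. This yields both the
    diagonal coefficients on [Cc] and the vectors that reach every [delta_g]. *)
Lemma lambda_delta_coord {A : cstarAlgType R} {iota : (G -> R[i]^o) -> A}
    {x : unit_space G} {lam : A -> ell2 R (fiber x) -> ell2 R (fiber x)} c t :
  is_lambda iota lam -> Cc c ->
  lam (iota c) (ell2_delta (fiber x) (set_val x)) t = c (set_val t).
Proof.
move=> [_ lamE] cc; rewrite lamE//; last exact: fiber_unit.
rewrite rng_unit.
have finD := Cc_finite_fiber c (set_val x) cc; rewrite src_unit in finD.
set D := [set h | _] in finD.
rewrite -(fsbig_widen D) => [|h []//|h [/= hx nh]]; last first.
  have [->|/eqP h0] := eqVneq (c h) 0; first by rewrite scale0r.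
  by exfalso; apply: nh; split=> //; apply/eqP.
have tx : src (set_val t) = set_val x by rewrite set_valE; exact: set_mem (valP t).
rewrite fsbig_finite// hsum_sum_coord.
have E h : src h = set_val x ->
    (c h *: ell2_delta (fiber x) (gmul h (set_val x)) : ell2 R (fiber x)) t =
    (if h == set_val t then c h else 0).
  move=> hx; rewrite -hx gmul_srcr /= /delta_fun eq_sym.
  by case: eqP => _; [exact: mulr1|exact: mulr0].
rewrite (eq_big_seq (fun h => if h == set_val t then c h else 0)); last first.
  by move=> h; rewrite in_fset_set// => /set_mem[hx _]; exact: E.
(* If [c] vanishes at [t], then [t] is not in [D] and there is no term to single out. *)
have [ct0|ct0] := eqVneq (c (set_val t)) 0.
  by rewrite ct0 big1// => h _; case: eqP => // ->.
rewrite (bigD1_seq (set_val t))//=; last by rewrite in_fset_set//; exact: mem_set.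
by rewrite eqxx big1 ?addr0// => h /negbTE ->.
Qed.

End CcFunctions.

(** * Baire's theorem for regular locally compact spaces *)

Section Baire.
Context {X : topologicalType}.
Hypothesis regX : regular_space X.
Hypothesis lcX : locally_compact [set: X].

Lemma regular_shrink (x : X) (V : set X) : open V -> V x ->
  exists W : set X, [/\ open W, W x & closure W `<=` V].
Proof.
move=> oV Vx; have [W xW WV] := regX x V (open_nbhs_nbhs (conj oV Vx)).
exists W°; split; first exact: open_interior.
- exact: xW.
- exact: subset_trans (closureS (@interior_subset _ W)) WV.
Qed.

Lemma locally_compact_nbhs (x : X) : exists2 V, nbhs x V & compact V.
Proof.
by have [V xV [cV _]] := lcX x I; exists V => //; rewrite withinET in xV.
Qed.

(** Choose nonempty open sets [U n], the closure of [U n.+1] lying in [U n] minus the closure of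
    [F n], all inside a compact set. A cluster point of points picked from the [U n] lies in every
    closure, hence in [V] and in no [F n]. *)
Lemma meager_locally_compact (Z V : set X) :
  meager Z -> open V -> V !=set0 -> exists x, V x /\ ~ Z x.
Proof.
move=> [F [ndF ZF]] oV [x0 Vx0].
have step n (W : set X) : open W /\ W !=set0 -> exists W' : set X,
    (open W' /\ W' !=set0) /\ closure W' `<=` W `\` closure (F n).
  move=> [oW [x Wx]].
  have oWF : open (W `\` closure (F n)).
    by apply: openI => //; apply: closed_openC; exact: closed_closure.
  have [y [Wy Fy]] : (W `\` closure (F n)) !=set0.
    apply: contrapT => e; have : (closure (F n))° x.
      apply: filterS (open_nbhs_nbhs (conj oW Wx)) => y Wy.
      by apply: contrapT => nF; apply: e; exists y.
    by have := ndF n; rewrite /nowhere_dense => ->.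
  have [W' [oW' W'y W'W]] := regular_shrink y _ oWF (conj Wy Fy).
  by exists W'; split=> //; split=> //; exists y.
have [K x0K cK] := locally_compact_nbhs x0.
have [V0 [oV0 V0x V0V]] : exists W : set X,
    [/\ open W, W x0 & closure W `<=` V `&` K°].
  apply: regular_shrink; last by split.
  by apply: openI => //; exact: open_interior.
pose st := {W : set X | open W /\ W !=set0}.
pose next n (W : st) : st :=
  exist _ _ (svalP (cid (step n (sval W) (svalP W)))).1.
have nextP n (W : st) : closure (sval (next n W)) `<=` sval W `\` closure (F n).
  exact: (svalP (cid (step n (sval W) (svalP W)))).2.
have V0P : open V0 /\ V0 !=set0 by split=> //; exists x0.
pose U := fix U n : st := if n is m.+1 then next m (U m) else exist _ V0 V0P.
have Umono n m : (n <= m)%N -> sval (U m) `<=` sval (U n).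
  elim: m => [|m IH]; first by rewrite leqn0 => /eqP ->.
  rewrite leq_eqVlt => /orP[/eqP -> //|/IH]; apply: subset_trans.
  by move=> y /(@subset_closure _ _)/nextP[].
pose p n := sval (cid (svalP (U n)).2).
have pP n : sval (U n) (p n) by exact: svalP (cid (svalP (U n)).2).
have tail n : (p @ \oo) (sval (U n)).
  by exists n => // m nm; exact: Umono nm _ (pP m).
have [y [_ yp]] : (K `&` cluster (p @ \oo)) !=set0.
  apply: cK; apply: filterS (tail 0%N) => z Uz.
  by have [_ /interior_subset] := V0V _ (subset_closure Uz).
have yU n : closure (sval (U n)) y.
  by move=> B yB; exact: yp (tail n) yB.
exists y; split; first by have [] := V0V y (yU 0%N).
by move=> /ZF[n _ Fy]; have [_ []] := nextP n _ _ (yU n.+1); exact: subset_closure.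
Qed.

End Baire.

(** * Bump functions on bisections *)

Section Bump.
Context {R : realType}.

Lemma real_complex_continuous : continuous (fun t : R => t%:C : R[i]^o).
Proof.
move=> t; apply/cvgrPdist_lt => e /gt0_realC[-> e0]; near=> u.
rewrite -rmorphB normc_def /= expr0n addr0 sqrtr_sqr ltcR.
near: u; exact: cvgr_dist_lt.
Unshelve. all: by end_near. Qed.

Context {G : topGroupoidType}.
Hypothesis etaleG : etale G.
Hypothesis hausX : hausdorff_space (unit_space G).
Hypothesis lcX : locally_compact [set: unit_space G].

Lemma unit_space_completely_regular : completely_regular_space (unit_space G).
Proof. exact: (@locally_compact_completely_regular _ R). Qed.

Lemma unit_space_regular : regular_space (unit_space G).
Proof.
exact: (@completely_regular_regular R _ unit_space_completely_regular).
Qed.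

(* For a Urysohn function [f], [0] at [x] and [1] off [V], the function
   [max (1 - 2 f) 0] vanishes off the closed set [f <= 1/2], which lies in [V]. *)
Lemma bump_function (V : set (unit_space G)) x : open V -> V x ->
  exists (f : unit_space G -> R) (L : set (unit_space G)),
    [/\ continuous f, f x = 1, compact L, closed L & L `<=` V /\
        forall y, f y != 0 -> L y].
Proof.
move=> oV Vx; have [K xK cK] := locally_compact_nbhs lcX x.
have xVK : (V `&` K°) x by [].
have clB : closed (~` (V `&` K°)).
  by apply: open_closedC; apply: openI => //; exact: open_interior.
have /(uniform_separatorP (R := R))[f [cf f01 fx fB]] :=
  unit_space_completely_regular x _ clB (fun h => h xVK).
have fx0 : f x = 0 by apply: fx; exists x.
have fB1 y : ~ (V `&` K°) y -> f y = 1 by move=> yB; apply: fB; exists y.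
pose L := [set y | f y <= 2^-1].
have clL : closed L.
  have -> : L = f @^-1` [set t | t <= 2^-1] by [].
  by apply: closed_comp (@closed_le _ _) => y _; exact: cf.
have LV : L `<=` V `&` K°.
  move=> y; rewrite /L /= => fy; apply: contrapT => /fB1 E.
  by move: fy; rewrite E; lra.
exists (fun y => Num.max (1 - (f y + f y)) 0), L; split=> //.
- move=> y; pose one : unit_space G -> R^o := fun=> 1.
  pose zero : unit_space G -> R^o := fun=> 0.
  have c1 : {for y, continuous one} by exact: cst_continuous.
  have c0 : {for y, continuous zero} by exact: cst_continuous.
  have cf' : {for y, continuous (f : _ -> R^o)} by exact: cf.
  exact: continuous_max (continuousB c1 (continuousD cf' cf')) c0.
- by rewrite fx0 addr0 subr0; apply/max_idPl.
- apply: subclosed_compact clL cK _ => y /LV[_].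
  exact: interior_subset.
- split; first by move=> y /LV[].
  move=> y; rewrite /L /=; case: leP => // fy.
  rewrite max_r ?eqxx//; lra.
Qed.

Lemma Cc_bump (g : G) : exists c : G -> R[i]^o,
  [/\ Cc c, c g = 1 & forall h, src h = src g -> h <> g -> c h = 0].
Proof.
have [s bs sg] := etale_bisection etaleG g.
have [os [sX oS cs [f' f'K cf']] _] := bs.
have Sx : [set x : unit_space G | (src @` s) (set_val x)] (src_unit_space g).
  by exists g.
have [f [L [cf fg cL clL [LV f0]]]] := bump_function _ _ oS Sx.
pose c (h : G) : R[i]^o := if h \in s then (f (src_unit_space h))%:C else 0.
have cE (t : set_type s) : c (set_val t) = (f (src_unit_space (set_val t)))%:C.
  by rewrite /c set_valE (valP t).
have c0 h : ~ s h -> c h = 0.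
  by move=> nsh; rewrite /c ifF//; apply/negP => /set_mem.
have cont_src : continuous (fun t : set_type s => src_unit_space (set_val t)).
  move=> t; apply: continuous_comp; first exact: set_val_continuous.
  exact: src_unit_space_continuous.
exists c; split; last 2 first.
- by rewrite /c mem_set// fg.
- move=> h hg nhg; apply: c0 => sh; apply: nhg.
  exact: bisection_src_inj bs sh sg hg.
exists 1%N, (fun=> 1), (fun=> c); split; last first.
  by rewrite big_ord1 scale1r.
move=> _; exists s; split=> //.
  under eq_fun do rewrite cE.
  move=> t; apply: (continuous_comp (f := fun t : set_type s =>
      f (src_unit_space (set_val t)))).
    apply: continuous_comp; [exact: cont_src|exact: cf].
  exact: real_complex_continuous.
pose P := [set t : set_type s | L (src_unit_space (set_val t))].
have clP : closed P by apply: closed_comp clL => t _; exact: cont_src.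
have cP : compact P.
  apply: compact_set_val.
  have -> : set_val @` P = f' @` (set_val @` L).
    apply/seteqP; split=> [_ [t Pt <-]|_ [_ [y Ly <-] <-]].
      exists (src (set_val t)); first by exists (src_unit_space (set_val t)).
      by apply: f'K; rewrite set_valE; exact: set_mem (valP t).
    have [h sh hy] := LV y Ly.
    exists (sub_point sh); last by rewrite -hy f'K.
    rewrite /P /= (_ : src_unit_space _ = y)//; apply: set_val_inj.
    by rewrite -hy.
  apply: continuous_compact.
    apply: continuous_subspaceW cf' => _ [y Ly <-]; exact: LV.
  apply: continuous_compact cL; apply: continuous_subspaceT.
  exact: set_val_continuous.
apply: subclosed_compact cP _; first exact: closed_closure.
rewrite (closure_id P).1//; apply: closureS => t; rewrite /= cE => ft.
by apply: f0; apply: contra_neq ft => ->.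
Qed.

End Bump.

(** * Neighbourhoods in [BbM] *)

Section EssentialNorm.
Context {R : realType} {X : topologicalType}.
Implicit Types f g : @Bb R X.

(** The doubly indexed nowhere dense sets are enumerated by coding pairs as naturals; a number
    coding no pair gets the empty set. *)
Lemma meager_bigcup (Z : nat -> set X) :
  (forall n, meager (Z n)) -> meager (\bigcup_n Z n).
Proof.
move=> /choice[F FP].
exists (fun m => if choice.unpickle m is Some (n, k) then F n k else set0).
split=> [m|x [n _ Znx]].
  case: choice.unpickle => [[n k]|]; first by have [] := FP n.
  by rewrite /nowhere_dense closure0 interior0.
have [_ /(_ x Znx)[k _ Fx]] := FP n.
by exists (choice.pickle (n, k)) => //; rewrite choice.pickleK.
Qed.

Lemma Bb_classP f g :
  Bb_class f = Bb_class g <-> meager [set x | set_val f x != set_val g x].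
Proof.
split=> [/eqmodP/asboolP//|m]; by apply/eqmodP/asboolP.
Qed.

Lemma Bb_class_repr (b : BbM R X) : Bb_class (repr b) = b.
Proof. exact: reprK. Qed.

(** The open ball for the supremum modulo meager sets; the slack [r < e] is what makes it open. *)
Definition essentially_close (e : R) f : set (@Bb R X) :=
  [set g | exists2 r, r < e &
    meager [set x | r < rnorm (set_val g x - set_val f x)]].

Lemma open_essentially_close e f : open (essentially_close e f).
Proof.
rewrite openE => g [r re m]; apply/nbhs_set_typeP.
(* A uniform perturbation by less than half the slack raises the bound [r] only to
   [(e + r) / 2 < e]. *)
have d0 : 0 < (e - r) / 2 by rewrite divr_gt0// subr_gt0.
exists [set h : {uniform X -> R[i]^o} |
    forall x, rnorm (h x - set_val g x) < (e - r) / 2].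
  apply/uniform_nbhs.
  have d0' : 0 < ((e - r) / 2)%:C by rewrite ltcR.
  exists [set xy : R[i]^o * R[i]^o | ball xy.1 ((e - r) / 2)%:C xy.2]; split.
    exact: (entourage_ball _ (PosNum d0')).
  move=> h /= hg x; have := hg x I.
  by rewrite -ball_normE /ball_ /= ltr_rnorm -rnormN opprB.
move=> h /= hg; exists ((e + r) / 2); first by lra.
apply: meager_sub m => x /= hx.
have := rnormD (set_val h x - set_val g x) (set_val g x - set_val f x).
rewrite addrA subrK; have := hg x; lra.
Qed.

(** A chosen representative differs from the function on a meager set only, so the preimage of this
    set in [Bb] is the open set [essentially_close e f]. *)
Lemma nbhs_essentially_close e f : 0 < e ->
  nbhs (Bb_class f) [set b | essentially_close e f (repr b)].
Proof.
move=> e0; apply: open_nbhs_nbhs; split; last first.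
  exists 0 => //; have /Bb_classP := Bb_class_repr (Bb_class f).
  apply: meager_sub => x /= fx; apply: contraTneq fx => ->.
  by rewrite subrr rnorm0 ltxx.
rewrite /open /= /quotient_open.
rewrite (_ : _ @^-1` _ = essentially_close e f); first exact: open_essentially_close.
apply/seteqP; split=> g [r re m]; exists r => //.
  have /Bb_classP m' := Bb_class_repr (Bb_class g).
  apply: meager_sub (meagerU m' m) => x /= gx.
  have [E|] := eqVneq (set_val (repr (Bb_class g)) x) (set_val g x).
    by right; rewrite /= E.
  by left.
have /Bb_classP m' := Bb_class_repr (Bb_class g).
apply: meager_sub (meagerU m' m) => x /= gx.
have [E|] := eqVneq (set_val (repr (Bb_class g)) x) (set_val g x); last by left.
by right; rewrite /= -E.
Qed.

End EssentialNorm.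

(** * The kernel of the essential expectation *)

Section EssentialExpectation.
Context {R : realType} {G : topGroupoidType} {A : cstarAlgType R}.
Context {iota : (G -> R[i]^o) -> A} {EL : A -> BbM R (unit_space G)}.
Hypothesis dense_iota : dense (iota @` Cc).
Hypothesis EL_iota : is_EL iota EL.

(** Continuity of [EL] and density of [Cc] give one [c] that is close to [b] in norm and whose
    restriction to the units is close to [f] modulo a meager set. *)
Lemma EL_approx (b : A) f (e : R) : 0 < e -> EL b = Bb_class f ->
  exists c, [/\ Cc c, rnorm (b - iota c) < e &
    meager [set x : unit_space G | e < rnorm (c (set_val x) - set_val f x)]].
Proof.
move=> e0 Eb; have [cEL ELc] := EL_iota.
have e0' : 0 < e%:C by rewrite ltcR.
have bW : nbhs b (EL @^-1` [set b | essentially_close e f (repr b)]).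
  by apply: cEL; rewrite Eb; exact: nbhs_essentially_close.
have bB : nbhs b (ball b e%:C) by exact: nbhsx_ballx.
have : nbhs b
    (EL @^-1` [set b | essentially_close e f (repr b)] `&` ball b e%:C).
  exact: filterI.
rewrite nbhsE => -[V [oV Vb] VW].
have [a [Va [c cc ac]]] := dense_iota V (ex_intro _ b Vb) oV.
have [[r re m] ba] := VW _ Va; rewrite -ac in m ba.
exists c; split=> //; first by rewrite -ltr_rnorm; move: ba; rewrite -ball_normE.
have [fc fcE Ec] := ELc c cc.
have : Bb_class fc = Bb_class (repr (EL (iota c))) by rewrite Bb_class_repr.
move=> /Bb_classP m'; apply: meager_sub (meagerU m' m) => x /=.
rewrite -fcE => ex.
have [E|] := eqVneq (set_val fc x) (set_val (repr (EL (iota c))) x).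
  by right; rewrite /= -E; apply: lt_trans re ex.
by left.
Qed.

Hypothesis etaleG : etale G.
Hypothesis hausX : hausdorff_space (unit_space G).
Hypothesis lcX : locally_compact [set: unit_space G].
Context {lam : forall x : unit_space G,
  A -> ell2 R (fiber x) -> ell2 R (fiber x)}.
Hypothesis lam_lambda : forall x, is_lambda iota (lam x).

Let unit_delta (x : unit_space G) : ell2 R (fiber x) :=
  ell2_delta (fiber x) (set_val x).

Let unit_pt (x : unit_space G) : set_type (fiber x) := sub_point (fiber_unit x).

(* The diagonal coefficient [<lambda_x b delta_x, delta_x>]. *)
Let diag (x : unit_space G) (b : A) : R[i]^o :=
  lam x b (unit_delta x) (unit_pt x).

Let lam_rep x : star_representation (lam x).
Proof. by have [] := lam_lambda x. Qed.

Let diagB x b c : diag x (b - c) = diag x b - diag x c.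
Proof. by rewrite /diag (repB (lam_rep x)). Qed.

Let diag_iota x c : Cc c -> diag x (iota c) = c (set_val x).
Proof.
by move=> cc; rewrite /diag (lambda_delta_coord c _ (lam_lambda x) cc).
Qed.

(** Contractivity, applied to the unit vector [delta_x]. *)
Let diag_le x b : rnorm (diag x b) <= rnorm b.
Proof.
apply: le_trans (hsum_rnorm_coord (lam x b (unit_delta x)) (unit_pt x)) _.
rewrite -hsum_rnormE; apply: le_trans (rep_contractive (lam_rep x) _ _) _.
suff -> : rnorm (unit_delta x) = 1 by rewrite mulr1.
apply/eqP; rewrite -(@eqrXn2 _ 2) ?rnorm_ge0// expr1n; apply/eqP.
have := hip_rnorm (unit_delta x).
have -> : unit_delta x = ell2_delta (fiber x) (set_val (unit_pt x)) by [].
rewrite hip_ell2_delta ell2_delta_coord eqxx.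
by move=> /(congr1 (@complex.Re R)).
Qed.

Let diag_star_mul x a :
  diag x (cmul (cstar a) a) = (rnorm (lam x a (unit_delta x)) ^+ 2)%:C.
Proof.
have -> : diag x (cmul (cstar a) a) =
    hip (lam x (cmul (cstar a) a) (unit_delta x)) (unit_delta x).
  by apply: esym; exact: (hip_ell2_delta _ (unit_pt x)).
by rewrite (repM (lam_rep x)) (rep_adj (lam_rep x)) cstarK hip_rnorm.
Qed.

Lemma lambda_delta_eq0 a x : EL (cmul (cstar a) a) = Bb_class Bb0 ->
  safe_units x -> lam x a (ell2_delta (fiber x) (set_val x)) = 0.
Proof.
move=> Ea sx; apply: rnorm_eq0; apply/eqP; rewrite -sqrf_eq0; apply/eqP.
suff d0 : diag x (cmul (cstar a) a) = 0.
  by have := d0; rewrite diag_star_mul => /(congr1 (@complex.Re R)).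
apply: rnorm_eq0; apply/le_anti; rewrite rnorm_ge0 andbT.
apply/ler_addgt0Pl => e e0; rewrite addr0.
have e2 : 0 < e / 2 by rewrite divr_gt0.
have [c [cc ca m]] := EL_approx _ _ _ e2 Ea.
(* Otherwise, by continuity of [c] at the safe unit [x], the bound fails on a nonempty open set,
   which the exceptional meager set cannot contain. The other [e / 2] pays for replacing [cstar a a]
   by [c]. *)
have cx : rnorm (c (set_val x)) <= e / 2.
  rewrite leNgt; apply/negP => cx.
  have : nbhs x [set y : unit_space G | e / 2 < rnorm (c (set_val y))].
    have cvg_c : (fun y : unit_space G => c (set_val y)) @ x --> c (set_val x).
      apply: continuous_comp; first exact: set_val_continuous.
      exact: Cc_continuous cc sx.
    have d0 : 0 < (rnorm (c (set_val x)) - e / 2)%:C by rewrite ltcR subr_gt0.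
    have /cvgrPdist_lt/(_ _ d0) := cvg_c; apply: filterS => y.
    rewrite ltr_rnorm /=.
    have := rnorm_dist (c (set_val x)) (c (set_val y)).
    move=> /(le_trans (ler_norm _)); lra.
  rewrite nbhsE => -[V [oV Vx] VW].
  have regX := unit_space_regular (R := R) hausX lcX.
  have [y [/VW Wy]] := meager_locally_compact regX lcX _ _ m oV (ex_intro _ x Vx).
  by apply; rewrite /= subr0.
have := diag_le x (cmul (cstar a) a - iota c); rewrite diagB (diag_iota _ _ cc).
have := rnormD (diag x (cmul (cstar a) a) - c (set_val x)) (c (set_val x)).
rewrite subrK; lra.
Qed.

Hypothesis danger_meager :
  meager [set x : unit_space G | dangerous (set_val x)].

(** Let [f] represent [EL b] and let [c n] approximate [b] within [1/(n+1)]. At a safe unit outside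
    the countably many exceptional sets, [diag x b = 0] bounds [c n] and hence [|f x| <= 2/(n+1)]
    for all [n]. *)
Lemma EL_star_mul_eq0 a :
  (forall x, safe_units x -> lam x a (ell2_delta (fiber x) (set_val x)) = 0) ->
  EL (cmul (cstar a) a) = Bb_class Bb0.
Proof.
move=> a0; set b := cmul (cstar a) a.
have Eb : EL b = Bb_class (repr (EL b)) by rewrite Bb_class_repr.
rewrite Eb; apply/Bb_classP; set f := repr _.
have e0 n : 0 < n.+1%:R^-1 :> R by [].
have [c cP] := choice (fun n => EL_approx _ _ _ (e0 n) Eb).
have mZ n : meager [set x : unit_space G |
    n.+1%:R^-1 < rnorm (c n (set_val x) - set_val f x)] by have [] := cP n.
apply: meager_sub (meagerU danger_meager (meager_bigcup _ mZ)) => x /= fx.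
apply: contrapT => /not_orP[sx nZ]; move/eqP: fx; apply.
have small n : rnorm (set_val f x) <= n.+1%:R^-1 * 2.
  have [cc cb _] := cP n.
  have h1 : rnorm (c n (set_val x) - set_val f x) <= n.+1%:R^-1.
    by rewrite leNgt; apply/negP => h; apply: nZ; exists n.
  have := diag_le x (b - iota (c n)); rewrite diagB (diag_iota _ _ cc).
  rewrite /b diag_star_mul a0// rnorm0 expr0n sub0r rnormN -/b => h2.
  have := rnormD (c n (set_val x)) (- (c n (set_val x) - set_val f x)).
  rewrite rnormN opprB [X in rnorm X <= _]addrC subrK.
  move=> /le_trans; apply; rewrite mulr_natr mulr2n.
  by apply: lerD h1; exact: le_trans h2 (ltW cb).
apply: rnorm_eq0; apply/le_anti; rewrite rnorm_ge0 andbT.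
apply/ler_addgt0Pl => e e0'; rewrite addr0.
(* For this [n], [n + 1] exceeds [2 / e], so that [2/(n+1) <= e]. *)
apply: le_trans (small (Num.truncn (2 / e))) _.
rewrite ler_pdivrMl ?ltr0n// -ler_pdivrMr//.
by apply/ltW/truncnS_gt.
Qed.

End EssentialExpectation.

(** * Factoring a representation through a quotient *)

Section StarHom.
Context {R : realType} {A B : cstarAlgType R} {q : A -> B}.
Hypothesis q_hom : star_hom q.

Lemma star_homB a b : q (a - b) = q a - q b.
Proof.
case: q_hom => lin _ _; have := lin (-1) b a.
by rewrite !scaleN1r (addrC (- b)) => ->; rewrite addrC.
Qed.

Lemma star_hom_mul_eq0 a b : q a = 0 -> q (cmul a b) = 0.
Proof.
case: q_hom => _ qM _ qa; rewrite qM qa.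
by rewrite -[X in cmul X](scale0r (0 : B)) cmulZl scale0r.
Qed.

Lemma star_hom_eqP a b : q a = q b <-> q (a - b) = 0.
Proof.
by rewrite star_homB; split=> [->|/eqP]; rewrite ?subrr// subr_eq0 => /eqP.
Qed.

End StarHom.

(** Let [b] act as [Lam] of a chosen preimage. One inclusion of kernels makes this independent of
    the choice, hence multiplicative and linear; the other makes it injective. *)
Lemma rep_factor {R : realType} {A B : cstarAlgType R} {H : hilbertType R}
    {q : A -> B} {Lam : A -> H -> H} :
  star_hom q -> (forall b, exists a, q a = b) -> star_representation Lam ->
  (forall a, q a = 0 <-> forall xi, Lam a xi = 0) ->
  exists pi : B -> H -> H, [/\ star_representation pi, injective pi &
    forall a xi, pi (q a) xi = Lam a xi].
Proof.
move=> qh qs LamR ker.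
pose pre b := sval (cid (qs b)).
have preK b : q (pre b) = b by exact: svalP (cid (qs b)).
have Lam_q a b : q a = q b -> Lam a = Lam b.
  move=> /(star_hom_eqP qh)/ker ab; apply/funext => xi; apply/eqP.
  by rewrite -subr_eq0 -(repB LamR) ab.
have piE a : Lam (pre (q a)) = Lam a by apply: Lam_q; rewrite preK.
have [qlin qM qstar] := qh.
exists (fun b => Lam (pre b)); split=> [|b b' E|a xi]; last by rewrite piE.
  split=> [b|c b b' xi|b b' xi|b xi eta].
  - by case: LamR.
  - rewrite -{1}(preK b) -{1}(preK b') -qlin piE.
    by rewrite (repD LamR) (repZ LamR).
  - by rewrite -{1}(preK b) -{1}(preK b') -qM piE (repM LamR).
  - by rewrite -{2}(preK b) -qstar piE (rep_adj LamR).
rewrite -(preK b) -(preK b'); apply/(star_hom_eqP qh)/ker => xi.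
by rewrite (repB LamR) E subrr.
Qed.

Theorem proposition3p32 (R : realType) (G : topGroupoidType)
    (Cmax Cess : cstarAlgType R)
    (iota : (G -> R[i]^o) -> Cmax)
    (lam : forall x : unit_space G,
      Cmax -> ell2 R (fiber x) -> ell2 R (fiber x))
    (EL : Cmax -> BbM R (unit_space G))
    (q : Cmax -> Cess) :
  etale G ->
  hausdorff_space (unit_space G) ->
  locally_compact [set: unit_space G] ->
  (exists s : nat -> set G,
    (forall n, open_bisection (s n)) /\ \bigcup_n s n = [set: G]) ->
  is_Cmax iota ->
  (forall x : unit_space G, is_lambda iota (lam x)) ->
  is_EL iota EL ->
  is_Cess EL q ->
  exists Lam : Cmax -> ess_space R G -> ess_space R G,
    is_Lambda_ess lam Lam /\
    exists pi : Cess -> ess_space R G -> ess_space R G,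
      [/\ star_representation pi,
          injective pi &
          forall a xi, pi (q a) xi = Lam a xi].
Proof.
move=> etaleG hausX lcX cover [_ _ _ _ dense_iota] lamP ELP [qh qs qker].
have lamR x : star_representation (lam x) by have [] := lamP x.
have dm := dangerous_units_meager etaleG hausX cover.
pose Lam : Cmax -> ess_space R G -> ess_space R G :=
  direct_sum_rep (fun x : set_type (@safe_units G) => lamR (set_val x)).
have LamR : star_representation Lam by exact: direct_sum_rep_star.
exists Lam; split; first by split.
(* What remains is that [q] and [Lam] have the same kernel. For [q a = 0], it suffices to test each
   summand on its basis vectors. *)
apply: (rep_factor qh qs LamR) => a; split=> [qa xi|La].
  apply: hsum_ext => x; apply: (ell2_rep_eq0 _ (lamR (set_val x))) => g.
  have sx : safe_units (set_val x) by exact: set_mem (valP x).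
  have gx : src (set_val g) = src (set_val (set_val x)).
    by rewrite src_unit; exact: set_mem (valP g).
  have [c [cc cg c0]] := Cc_bump (R := R) etaleG hausX lcX (set_val g).
  have -> : ell2_delta (fiber (set_val x)) (set_val g) =
      lam (set_val x) (iota c)
        (ell2_delta (fiber (set_val x)) (set_val (set_val x))).
    apply: hsum_ext => t; rewrite (lambda_delta_coord c t (lamP _) cc).
    rewrite ell2_delta_coord; have [->|/eqP tg] := eqVneq t g; first by rewrite cg.
    rewrite c0//; last by move=> /set_val_inj.
    by rewrite gx src_unit; exact: set_mem (valP t).
  rewrite -(repM (lamR _)).
  apply: (lambda_delta_eq0 dense_iota ELP hausX lcX lamP) => //.
  by apply/qker; exact: star_hom_mul_eq0 qa.
apply/qker; apply: (EL_star_mul_eq0 dense_iota ELP lamP dm) => x sx.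
have sx' : x \in @safe_units G by exact: mem_set.
exact: (direct_sum_rep_eq0 _ _ La (SigSub sx')).
Qed.
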